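(* Let $n > 1$. (1) For each $\lambda \in E_n$, there exists a Type Q simple $\mathbb{C}S_n$-supermodule $W^\lambda$ such that $W^\lambda \cong S^\lambda \oplus S^{\lambda'}$ as a $|\mathbb{C}S_n|$-module, with $$W^\lambda_{\overline{0}} = \{ u+\phi^\lambda(u) : u \in S^\lambda\} \quad\text{and}\quad W^\lambda_{\overline{1}} = \{ u-\phi^\lambda(u) : u \in S^\lambda\}.$$ The $|\mathbb{C}S_n|$-module decomposition $W^\lambda \cong S^\lambda\oplus S^{\lambda'}$ is canonical. (2) For each $\lambda \in F_n$, there exists a Type M simple $\mathbb{C}S_n$-supermodule $W^\lambda$ such that $W^\lambda \cong S^\lambda$ as a $|\mathbb{C}S_n|$-module, with $W^\lambda_{\overline{0}} = S^{\lambda^+}$ and $W^\lambda_{\overline{1}} = S^{\lambda^-}$. The set $\{ W^\lambda : \lambda \in \overline{\mathcal{P}}(n)\}$ is a complete set of pairwise non-isomorphic simple $\mathbb{C}S_n$-supermodules, up to homogeneous (even or odd) isomorphism.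
   Context: All vector spaces are over $\mathbb{C}$; ''super'' means $\mathbb{Z}_2$-graded, $V=V_{\overline 0}\oplus V_{\overline 1}$. The group algebra $\mathbb{C}S_n$ is a superalgebra with even part $\mathbb{C}A_n$ and odd part the span of the odd permutations. For a superalgebra $A$, $|A|$ denotes $A$ as an ordinary (ungraded) algebra. A simple $A$-supermodule (no proper nonzero graded submodules) is of Type M if it is simple as an $|A|$-module, and of Type Q if it is reducible as an $|A|$-module. A homogeneous homomorphism $f:M\to N$ of $A$-supermodules is an even or odd linear map with $f(am)=(-1)^{\overline a\cdot\overline f}af(m)$. For a partition $\lambda$ of $n$, $\lambda'$ is the conjugate (transpose) partition and $S^\lambda$ is the Specht module (a simple $|\mathbb{C}S_n|$-module). $\overline{\mathcal{P}}(n)$ is a fixed set of representatives for the classes $\{\lambda,\lambda'\}$ of partitions of $n$, with $(n)\in\overline{\mathcal{P}}(n)$; $E_n = \{\lambda\in\overline{\mathcal{P}}(n):\lambda\neq\lambda'\}$ and $F_n=\{\lambda\in\overline{\mathcal{P}}(n):\lambda=\lambda'\}$. For each $\lambda\vdash n$ fix a linear isomorphism $\phi^\lambda:S^\lambda\to S^{\lambda'}$ with $\phi^\lambda(\sigma v)=\operatorname{sgn}(\sigma)\,\sigma\phi^\lambda(v)$ for all $\sigma\in S_n$, $v\in S^\lambda$, chosen so that $\phi^{\lambda'}\circ\phi^\lambda=\mathrm{id}_{S^\lambda}$. For $\lambda=\lambda'$, let $S^{\lambda^+}$, $S^{\lambda^-}$ be the $+1$ and $-1$ eigenspaces of $\phi^\lambda$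 (simple, non-isomorphic $\mathbb{C}A_n$-modules). ''Canonical'' means that the two summands are the (uniquely determined) isotypical components of the $|\mathbb{C}S_n|$-module $W^\lambda$. *)

(* Defs.v *)
From HB Require Import structures.
From mathcomp Require Import all_boot all_order all_algebra all_fingroup.
From mathcomp Require Import boolp classical_sets.
From mathcomp Require Import complex reals.

Set Implicit Arguments.
Unset Strict Implicit.
Unset Printing Implicit Defensive.

Import GRing.Theory.

Local Open Scope ring_scope.
Local Open Scope classical_set_scope.

Section Modules.

Section OverRing.
Variable A : pzRingType.

Definition is_submodule (V : lmodType A) (U : set V) : Prop :=
  U 0 /\ forall (a : A) (u v : V), U u -> U v -> U (a *: u + v).

Definition simple_module (V : lmodType A) : Prop :=
  [set: V] <> [set 0] /\
  forall U : set V, is_submodule U -> U = [set 0] \/ U = [set: V].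

Definition reducible_module (V : lmodType A) : Prop :=
  exists U : set V, [/\ is_submodule U, U <> [set 0] & U <> [set: V]].

Definition module_iso (V W : lmodType A) (f : V -> W) : Prop :=
  linear f /\ bijective f.

(* The sum of all submodules of V that are isomorphic to T. *)
Definition isotypical_component (V T : lmodType A) : set V :=
  [set v | forall U : set V, is_submodule U ->
     (forall g : T -> V, linear g -> injective g -> range g `<=` U) -> U v].
Arguments isotypical_component : clear implicits.

Definition isotypical_components (V : lmodType A) : set (set V) :=
  [set U | exists T : lmodType A,
     [/\ simple_module T, U = isotypical_component V T & U <> [set 0]]].

End OverRing.

(* Z_2-gradings are indexed by bool: false is the even part, true the odd part,
   and addition of parities is addb. *)
Definition direct_sum2 (V : zmodType) (g : bool -> set V) : Prop :=
  forall v : V, exists! p : V * V, [/\ g false p.1, g true p.2 & v = p.1 + p.2].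

Record superalgebra_grading (F : fieldType) (A : algType F) := SuperalgebraGrading {
  sa_part :> bool -> set A;
  sa_subspace : forall i, is_submodule (sa_part i);
  sa_direct : direct_sum2 sa_part;
  sa_mul : forall i j a b, sa_part i a -> sa_part j b ->
             sa_part (i (+) j) (a * b)
}.

Section OverAlgebra.
Variables (F : fieldType) (A : algType F).

(* The F-vector space structure of an A-module V is k . v = k%:A *: v. *)
Definition is_subspace (V : lmodType A) (U : set V) : Prop :=
  U 0 /\ forall (k : F) (u v : V), U u -> U v -> U (k%:A *: u + v).

Definition field_linear (V W : lmodType A) (f : V -> W) : Prop :=
  forall (k : F) (u v : V), f (k%:A *: u + v) = k%:A *: f u + f v.

Variable gA : superalgebra_grading A.

Record supermodule := Supermodule {
  sm_module :> lmodType A;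
  sm_part : bool -> set sm_module;
  sm_subspace : forall i, is_subspace (sm_part i);
  sm_direct : direct_sum2 sm_part;
  sm_act : forall i j a v, gA i a -> sm_part j v -> sm_part (i (+) j) (a *: v)
}.

Arguments sm_part : clear implicits.

Definition graded_submodule (V : supermodule) (U : set V) : Prop :=
  is_submodule U /\
  forall v0 v1, sm_part V false v0 -> sm_part V true v1 -> U (v0 + v1) ->
    U v0 /\ U v1.

Definition simple_supermodule (V : supermodule) : Prop :=
  [set: V] <> [set 0] /\
  forall U : set V, graded_submodule U -> U = [set 0] \/ U = [set: V].

Definition type_M (V : supermodule) : Prop :=
  simple_supermodule V /\ simple_module V.

Definition type_Q (V : supermodule) : Prop :=
  simple_supermodule V /\ reducible_module V.

Definition homogeneous_hom (b : bool) (V W : supermodule) (f : V -> W) : Prop :=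
  [/\ field_linear f,
      forall i v, sm_part V i v -> sm_part W (i (+) b) (f v) &
      forall i a v, gA i a -> f (a *: v) = (-1) ^+ (i && b) *: (a *: f v)].

Definition homogeneously_isomorphic (V W : supermodule) : Prop :=
  exists (b : bool) (f : V -> W), homogeneous_hom b f /\ bijective f.

End OverAlgebra.
End Modules.
Arguments isotypical_component {A} _ _.
Arguments isotypical_components {A} _.
Arguments sm_part {F A gA} _ _.

Section GroupAlgebra.
Variables (F : fieldType) (gT : finGroupType).

(* The function a : gT -> F stands for the formal sum of the a(g) g. *)
Definition grpalg := {ffun gT -> F}.

HB.instance Definition _ := GRing.Zmodule.on grpalg.

Definition grpalg_scale (k : F) (a : grpalg) : grpalg := [ffun g => k * a g].

Definition grpalg_elt (g : gT) : grpalg := [ffun h => (h == g)%:R].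

Definition grpalg_mul (a b : grpalg) : grpalg :=
  [ffun g => \sum_h a h * b (h^-1 * g)%g].

Fact grpalg_scaleA k l a :
  grpalg_scale k (grpalg_scale l a) = grpalg_scale (k * l) a.
Proof. by apply/ffunP=> g; rewrite !ffunE mulrA. Qed.

Fact grpalg_scale1 : left_id 1 grpalg_scale.
Proof. by move=> a; apply/ffunP=> g; rewrite !ffunE mul1r. Qed.

Fact grpalg_scaleDr : right_distributive grpalg_scale +%R.
Proof. by move=> k a b; apply/ffunP=> g; rewrite !ffunE mulrDr. Qed.

Fact grpalg_scaleDl a : {morph grpalg_scale^~ a : k l / k + l}.
Proof. by move=> k l; apply/ffunP=> g; rewrite !ffunE mulrDl. Qed.

HB.instance Definition _ := GRing.Zmodule_isLmodule.Build F grpalg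
  grpalg_scaleA grpalg_scale1 grpalg_scaleDr grpalg_scaleDl.

Fact grpalg_mulA : associative grpalg_mul.
Proof.
move=> a b c; apply/ffunP=> g; rewrite !ffunE.
under eq_bigr => h _ do rewrite ffunE big_distrr /=.
under [RHS]eq_bigr => h _ do rewrite ffunE big_distrl /=.
rewrite [RHS]exchange_big /=; apply: eq_bigr => h _.
rewrite [RHS](reindex_inj (mulgI h)) /=; apply: eq_bigr => k _.
by rewrite mulKg invMg mulgA mulrA.
Qed.

Fact grpalg_mul1 : left_id (grpalg_elt 1%g) grpalg_mul.
Proof.
move=> a; apply/ffunP=> g; rewrite !ffunE (bigD1 1%g) //= big1 => [|h /negbTE nh].
  by rewrite ffunE eqxx mul1r invg1 mul1g addr0.
by rewrite ffunE nh mul0r.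
Qed.

Fact grpalg_mulr1 : right_id (grpalg_elt 1%g) grpalg_mul.
Proof.
move=> a; apply/ffunP=> g; rewrite !ffunE (bigD1 g) //= big1 => [|h nh].
  by rewrite ffunE mulVg eqxx mulr1 addr0.
rewrite ffunE; case: eqP => [e|_]; last by rewrite mulr0.
by case/eqP: nh; apply: (mulgI (h^-1)%g); rewrite e mulVg.
Qed.

Fact grpalg_mulDl : left_distributive grpalg_mul +%R.
Proof.
move=> a b c; apply/ffunP=> g; rewrite !ffunE -big_split /=.
by apply: eq_bigr => h _; rewrite ffunE mulrDl.
Qed.

Fact grpalg_mulDr : right_distributive grpalg_mul +%R.
Proof.
move=> a b c; apply/ffunP=> g; rewrite !ffunE -big_split /=.
by apply: eq_bigr => h _; rewrite ffunE mulrDr.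
Qed.

Fact grpalg_1_neq0 : grpalg_elt 1%g != 0.
Proof.
apply/eqP=> /ffunP/(_ 1%g); rewrite !ffunE eqxx; apply/eqP; exact: oner_neq0.
Qed.

HB.instance Definition _ := GRing.Zmodule_isNzRing.Build grpalg
  grpalg_mulA grpalg_mul1 grpalg_mulr1 grpalg_mulDl grpalg_mulDr grpalg_1_neq0.

Fact grpalg_scaleAl (k : F) (a b : grpalg) : k *: (a * b) = (k *: a) * b.
Proof.
apply/ffunP=> g; rewrite !ffunE big_distrr /=.
by apply: eq_bigr => h _; rewrite ffunE mulrA.
Qed.

HB.instance Definition _ := GRing.Lmodule_isLalgebra.Build F grpalg grpalg_scaleAl.

Fact grpalg_scaleAr (k : F) (a b : grpalg) : k *: (a * b) = a * (k *: b).
Proof.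
apply/ffunP=> g; rewrite !ffunE big_distrr /=.
by apply: eq_bigr => h _; rewrite ffunE mulrCA.
Qed.

HB.instance Definition _ := GRing.Lalgebra_isAlgebra.Build F grpalg grpalg_scaleAr.

End GroupAlgebra.

Section SymmetricGroupSuperalgebra.
Variables (F : fieldType) (n : nat).

Definition symalg := grpalg F 'S_n.
HB.instance Definition _ := GRing.Algebra.on symalg.

Definition symalg_part (i : bool) : set symalg :=
  [set a | forall s : 'S_n, odd_perm s != i -> a s = 0].

Fact symalg_subspace i : is_submodule (symalg_part i).
Proof.
split=> [s _|k a b a_i b_i s s_i]; rewrite !ffunE //.
by rewrite a_i // b_i // mulr0 addr0.
Qed.

Fact symalg_direct : direct_sum2 symalg_part.
Proof.
move=> a; exists ([ffun s => if odd_perm s then 0 else a s],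
                  [ffun s => if odd_perm s then a s else 0]); split.
  split=> /= [s|s|]; rewrite ?ffunE; try by case: odd_perm.
  by apply/ffunP=> s; rewrite !ffunE; case: odd_perm; rewrite ?add0r ?addr0.
move=> [b c] /= [b0 c1 ->]; congr pair; apply/ffunP=> s; rewrite !ffunE;
  case: ifPn => s_odd.
- by rewrite b0 ?s_odd.
- by rewrite c1 ?addr0 // (negbTE s_odd).
- by rewrite b0 ?add0r ?s_odd.
- by rewrite c1 // (negbTE s_odd).
Qed.

Fact symalg_part_mul i j (a b : symalg) : symalg_part i a -> symalg_part j b ->
  symalg_part (i (+) j) (a * b).
Proof.
move=> a_i b_j s s_ij; rewrite ffunE big1 // => t _.
have [t_i|t_i] := eqVneq (odd_perm t) i; last by rewrite a_i ?mul0r.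
rewrite b_j ?mulr0 // odd_permM odd_permV t_i.
by apply: contraNneq s_ij => <-; rewrite addKb.
Qed.

Definition symalg_super : superalgebra_grading symalg :=
  SuperalgebraGrading symalg_subspace symalg_direct symalg_part_mul.

End SymmetricGroupSuperalgebra.

Section Partitions.
Variable n : nat.

Definition is_intpart (p : seq nat) : bool :=
  [&& sorted geq p, 0%N \notin p & sumn p == n].

Definition intpart := {p : seq nat | is_intpart p}.

Definition conj_seq (p : seq nat) : seq nat :=
  mkseq (fun j => count (fun r => (j < r)%N) p) (head 0%N p).

Fact conj_is_intpart (p : intpart) : is_intpart (conj_seq (val p)).
Proof.
case: p => p /= /and3P[p_dec p_pos /eqP sum_p]; apply/and3P; split.
- rewrite sorted_map; apply: sub_sorted (iota_ltn_sorted 0 _) => i j /= ij.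
  by apply: sub_count => r /=; apply: ltn_trans.
- apply/negP=> /mapP[j]; rewrite mem_iota add0n /= => j_lt /esym/eqP.
  case: p {p_dec p_pos sum_p} j_lt => //= r p j_lt; by rewrite j_lt.
- have le_head r : r \in p -> (r <= head 0 p)%N.
    case: p p_dec {p_pos sum_p} => //= x p; rewrite path_sortedE; last first.
      by move=> a b c /= ba cb; apply: leq_trans cb ba.
    case/andP=> /allP le_x _; rewrite inE => /orP[/eqP->//|]; exact: le_x.
  rewrite /conj_seq /mkseq sumnE big_map.
  under eq_bigr => j _ do rewrite -sum1_count big_mkcond.
  rewrite exchange_big /= -[X in _ == X]sum_p sumnE; apply/eqP.
  rewrite !big_seq; apply: eq_bigr => r /le_head r_le.
  rewrite -big_mkcond /= sum1_count.
  rewrite -(subnKC r_le) iotaD count_cat add0n.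
  rewrite (@eq_in_count _ _ predT) ?count_predT ?size_iota; last first.
    by move=> j; rewrite mem_iota.
  rewrite (@eq_in_count _ _ pred0) ?count_pred0 ?addn0 //.
  by move=> j; rewrite mem_iota /= [(j < r)%N]ltnNge => /andP[-> _].
Qed.

Definition conj_part (p : intpart) : intpart :=
  exist _ (conj_seq (val p)) (conj_is_intpart p).

Definition is_conj_representatives (P : set intpart) : Prop :=
  (forall p : intpart, exists! q : intpart, P q /\ (q = p \/ q = conj_part p)) /\
  (exists2 p : intpart, P p & val p = [:: n]).

Definition part_E (P : set intpart) : set intpart :=
  [set p | P p /\ p <> conj_part p].

Definition part_F (P : set intpart) : set intpart :=
  [set p | P p /\ p = conj_part p].

End Partitions.

Section Specht.
Variables (F : fieldType) (n : nat).

(* The tabloid whose i-th row is {x | w x = i} is encoded by the word w; the free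
   module on the words is the direct sum of the permutation modules M^mu over the
   weak compositions mu of n with n parts, and 'S_n acts on words by
   s . w = w \o s.  As (s * t) x = t (s x) in 'S_n, this is a left action; it is
   the usual place permutation w \o s^-1 once 'S_n is identified, by inversion,
   with the group of permutations in which (s t) x = s (t x). *)
Definition word := {ffun 'I_n -> 'I_n}.

Definition wordmod := {ffun word -> F}.
HB.instance Definition _ := GRing.Zmodule.on wordmod.

Definition word_act (s : 'S_n) (w : word) : word := [ffun x => w (s x)].

Definition wordmod_elt (w : word) : wordmod := [ffun u => (u == w)%:R].

Definition wordmod_scale (a : symalg F n) (f : wordmod) : wordmod :=
  [ffun w => \sum_(s : 'S_n) a s * f (word_act s^-1%g w)].

Fact word_actM s t w : word_act (s * t)%g w = word_act s (word_act t w).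
Proof. by apply/ffunP=> x; rewrite !ffunE permM. Qed.

Fact word_act1 w : word_act 1%g w = w.
Proof. by apply/ffunP=> x; rewrite !ffunE perm1. Qed.

Fact wordmod_scaleA a b f :
  wordmod_scale a (wordmod_scale b f) = wordmod_scale (a * b) f.
Proof.
apply/ffunP=> w; rewrite !ffunE.
under eq_bigr => s _ do rewrite ffunE big_distrr /=.
under [RHS]eq_bigr => s _ do rewrite ffunE big_distrl /=.
rewrite [RHS]exchange_big /=; apply: eq_bigr => s _.
rewrite [RHS](reindex_inj (mulgI s)) /=; apply: eq_bigr => t _.
by rewrite mulKg invMg word_actM mulrA.
Qed.

Fact wordmod_scale1 : left_id 1 wordmod_scale.
Proof.
move=> f; apply/ffunP=> w; rewrite !ffunE (bigD1 1%g) //= big1 => [|s /negbTE ns].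
  by rewrite ffunE eqxx mul1r invg1 word_act1 addr0.
by rewrite ffunE ns mul0r.
Qed.

Fact wordmod_scaleDr : right_distributive wordmod_scale +%R.
Proof.
move=> a f g; apply/ffunP=> w; rewrite !ffunE -big_split /=.
by apply: eq_bigr => s _; rewrite ffunE mulrDr.
Qed.

Fact wordmod_scaleDl f : {morph wordmod_scale^~ f : a b / a + b}.
Proof.
move=> a b; apply/ffunP=> w; rewrite !ffunE -big_split /=.
by apply: eq_bigr => s _; rewrite ffunE mulrDl.
Qed.

HB.instance Definition _ := GRing.Zmodule_isLmodule.Build (symalg F n) wordmod
  wordmod_scaleA wordmod_scale1 wordmod_scaleDr wordmod_scaleDl.

(* A tableau maps each entry to its cell (row, column), counted from 0; since
   |p| = n, an injection from the entries to the cells of p is a bijection. *)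
Definition tableau := {ffun 'I_n -> 'I_n * 'I_n}.

Definition is_tableau (p : intpart n) (t : tableau) : bool :=
  injectiveb t && [forall x, ((t x).2 < nth 0%N (val p) (t x).1)%N].

Definition tabloid (t : tableau) : word := [ffun x => (t x).1].

Definition column_stabiliser (t : tableau) : pred 'S_n :=
  [pred s : 'S_n | [forall x, (t (s x)).2 == (t x).2]].

Definition polytabloid (t : tableau) : wordmod :=
  \sum_(s : 'S_n | column_stabiliser t s)
    (-1) ^+ s *: (grpalg_elt F s *: wordmod_elt (tabloid t)).

Definition specht_set (p : intpart n) : set wordmod :=
  [set v | exists c : tableau -> F,
     v = \sum_(t : tableau | is_tableau p t) (c t)%:A *: polytabloid t].

Definition tableau_act (s : 'S_n) (t : tableau) : tableau := [ffun x => t (s x)].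

Fact tableau_act_inj s : injective (tableau_act s).
Proof.
move=> t u /ffunP tu; apply/ffunP=> x.
by move: (tu (s^-1%g x)); rewrite !ffunE permKV.
Qed.

Fact is_tableau_act p s t : is_tableau p (tableau_act s t) = is_tableau p t.
Proof.
congr andb; apply/idP/idP.
- move/injectiveP=> t_inj; apply/injectiveP=> x y txy.
  apply: (perm_inj (s := s^-1%g)); apply: t_inj.
  by rewrite !ffunE !permKV.
- move/injectiveP=> t_inj; apply/injectiveP=> x y; rewrite !ffunE.
  by move/t_inj/perm_inj.
- by move/forallP=> lt_t; apply/forallP=> x; move: (lt_t (s^-1%g x)); rewrite ffunE permKV.
- by move/forallP=> lt_t; apply/forallP=> x; rewrite ffunE.
Qed.

Fact grpalg_eltM s t : grpalg_elt F s * grpalg_elt F t = grpalg_elt F (s * t)%g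
  :> symalg F n.
Proof.
apply/ffunP=> g; rewrite !ffunE (bigD1 s) //= big1 => [|h /negbTE ns].
  by rewrite !ffunE eqxx mul1r addr0 -(inj_eq (mulgI s)) mulKVg.
by rewrite !ffunE ns mul0r.
Qed.

Fact wordmod_eltZ (s : 'S_n) w :
  (grpalg_elt F s : symalg F n) *: wordmod_elt w = wordmod_elt (word_act s w).
Proof.
apply/ffunP=> u; rewrite !ffunE (bigD1 s) //= big1 => [|h /negbTE ns].
  rewrite !ffunE eqxx mul1r addr0; congr (_%:R); congr nat_of_bool.
  apply/eqP/eqP=> [<-|->]; first by rewrite -word_actM mulgV word_act1.
  by rewrite -word_actM mulVg word_act1.
by rewrite !ffunE ns mul0r.
Qed.

Fact polytabloid_act (s : 'S_n) t :
  (grpalg_elt F s : symalg F n) *: polytabloid t = polytabloid (tableau_act s t).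
Proof.
rewrite /polytabloid scaler_sumr [RHS](reindex_inj (conjg_inj s^-1%g)) /=.
apply: eq_big => [u|u _].
  apply/forallP/forallP=> /= u_col x.
    by move: (u_col (s x)); rewrite !ffunE conjgE invgK !permM permKV.
  by move: (u_col (s^-1%g x)); rewrite !ffunE conjgE invgK !permM !permKV.
have -> : tabloid (tableau_act s t) = word_act s (tabloid t).
  by apply/ffunP=> x; rewrite !ffunE.
rewrite odd_permJ !wordmod_eltZ.
have -> : word_act (u ^ s^-1)%g (word_act s (tabloid t)) =
          word_act s (word_act u (tabloid t)).
  by rewrite -!word_actM conjgE invgK -mulgA mulgKV.
case: odd_perm; rewrite ?expr1 ?expr0 ?scale1r ?scaleN1r ?scalerN ?wordmod_eltZ //.
Qed.

Fact grpalg_sum (a : symalg F n) : a = \sum_(s : 'S_n) (a s)%:A * grpalg_elt F s.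
Proof.
apply/ffunP=> g; rewrite sum_ffunE (bigD1 g) //= big1 => [|s /negbTE ns].
  by rewrite mulr_algl !ffunE eqxx mulr1 addr0.
by rewrite mulr_algl !ffunE eq_sym ns mulr0.
Qed.

Fact specht_submod p : is_submodule (specht_set p).
Proof.
have spechtD u v : specht_set p u -> specht_set p v -> specht_set p (u + v).
  move=> [c ->] [d ->]; exists (fun t => c t + d t); rewrite -big_split /=.
  by apply: eq_bigr => t _; rewrite [in RHS]scalerDl [RHS]scalerDl.
have spechtZ k u : specht_set p u -> specht_set p (k%:A *: u).
  move=> [c ->]; exists (fun t => k * c t); rewrite scaler_sumr.
  by apply: eq_bigr => t _; rewrite scalerA mulr_algl scalerA.
have specht0 : specht_set p 0.
  by exists (fun=> 0); rewrite big1 // => t _; rewrite !scale0r.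
split=> // a u v Su Sv; apply: (spechtD) => //.
rewrite [a]grpalg_sum scaler_suml; elim/big_ind: _ => // s _.
rewrite -scalerA; apply: spechtZ; case: Su => c ->.
exists (fun t => c (tableau_act s^-1%g t)); rewrite scaler_sumr.
rewrite [RHS](reindex_inj (@tableau_act_inj s)) /=.
apply: eq_big => [t|t _]; first by rewrite is_tableau_act.
rewrite -polytabloid_act scalerA [in RHS]scalerA; congr (_ *: _).
have -> : tableau_act s^-1%g (tableau_act s t) = t.
  by apply/ffunP=> x; rewrite !ffunE permKV.
by rewrite mulr_algl mulr_algr.
Qed.

Definition specht_pred (p : intpart n) : {pred wordmod} :=
  [pred v | v \in specht_set p].

Fact specht_pred_submod p : submod_closed (specht_pred p).
Proof.
have [S0 SD] := specht_submod p; split; first by apply/mem_set.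
by move=> a u v /set_mem Su /set_mem Sv; apply/mem_set/SD.
Qed.

HB.instance Definition _ p :=
  GRing.isSubmodClosed.Build (symalg F n) wordmod (specht_pred p)
    (specht_pred_submod p).

Definition specht (p : intpart n) := {v : wordmod | v \in specht_pred p}.

HB.instance Definition _ p := SubType.on (specht p).
HB.instance Definition _ p := Choice.on (specht p).
HB.instance Definition _ p :=
  [SubChoice_isSubLmodule of specht p by <:].

End Specht.

Section Associators.
Variables (F : fieldType) (n : nat).

(* All the Specht modules of S_n lie in the same wordmod F n, so the composite
   phi^{p'} \o phi^p, whose codomain is specht F (conj_part (conj_part p)), is
   compared with the identity of specht F p there. *)
Definition associator_family
    (phi : forall p : intpart n, specht F p -> specht F (conj_part p)) : Prop :=
  [/\ forall p, field_linear (phi p),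
      forall p, bijective (phi p),
      forall p (s : 'S_n) (v : specht F p),
        phi p ((grpalg_elt F s : symalg F n) *: v) =
        (-1) ^+ s *: ((grpalg_elt F s : symalg F n) *: phi p v) &
      forall p v, val (phi (conj_part p) (phi p v)) = val v].

(* For p = conj_part p, where specht F p and specht F (conj_part p) are the same
   subspace of wordmod F n. *)
Definition specht_plus (phi : forall p : intpart n, specht F p -> specht F (conj_part p))
    (p : intpart n) : set (specht F p) :=
  [set v | val (phi p v) = val v].

Definition specht_minus (phi : forall p : intpart n, specht F p -> specht F (conj_part p))
    (p : intpart n) : set (specht F p) :=
  [set v | val (phi p v) = - val v].

End Associators.
Arguments specht_plus {F n} phi p _.
Arguments specht_minus {F n} phi p _.

(* Main.v *)
Require Import Defs.
From HB Require Import structures.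
From mathcomp Require Import all_boot all_order all_algebra all_fingroup.
From mathcomp Require Import boolp classical_sets.
From mathcomp Require Import complex reals.
From mathcomp Require Import zify.

(* The Specht modules over C are simple, pairwise non-isomorphic, and every
   nonzero CS_n-module V receives a nonzero map from one of them.  Simplicity and
   non-isomorphism are James' arguments: the signed column sum kappa_t maps the
   permutation module M^lambda to the line of the polytabloid e_t, and kills
   M^mu unless lambda dominates mu.  For completeness, to each shape lambda with
   row sum rho and column sum kappa attach the central element
   z_lambda = sum_g g (kappa rho)(kappa rho)^* g^-1.  Since z_lambda is
   self-adjoint, z_lambda^2 <> 0, while z_lambda z_mu = 0 for lambda <> mu; so the
   z_lambda are linearly independent, and as conjugacy classes are determined by
   their cycle types, 1 is a combination of them.  Hence kappa_t rho_t w <> 0 for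
   some t and some w in V, and {t} |-> rho_t w induces a map S^lambda -> V that
   does not vanish on e_t.

   A grading of a module V compatible with that of CS_n is the same as an
   involution tau of V with tau(s v) = sgn(s) s tau(v).  On S^lambda + S^lambda' it
   exchanges the summands by phi; on S^lambda, lambda = lambda', it is phi.  A map
   g from S^lambda to a simple supermodule with involution tau extends to the
   even map (u, w) |-> g u + tau g phi^-1 w on S^lambda + S^lambda', and when
   lambda = lambda' one of g + tau g phi, g - tau g phi is nonzero. *)

Set Implicit Arguments.
Unset Strict Implicit.
Unset Printing Implicit Defensive.

(** * Tableaux and cycle types *)

Section Tableaux.
Variable n : nat.
Implicit Types (p q : intpart n) (t u : tableau n) (w : word n).

Definition cells p : {set 'I_n * 'I_n} :=
  [set c : 'I_n * 'I_n | (c.2 < nth 0 (val p) c.1)%N].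

Lemma intpart_part_le p i : (nth 0%N (val p) i <= n)%N.
Proof.
case: p => p /= /and3P[_ _ /eqP <-]; elim: p i => [|r p IH] [|i] //=.
  exact: leq_addr.
exact: leq_trans (IH i) (leq_addl _ _).
Qed.

Lemma intpart_size_le p : (size (val p) <= n)%N.
Proof.
case: p => p /= /and3P[_ p0 /eqP <-]; elim: p p0 => //= r p IH.
by rewrite inE negb_or eq_sym -lt0n => /andP[r0 /IH]; lia.
Qed.

Lemma sum_parts p : \sum_(i < n) nth 0 (val p) i = n.
Proof.
have /and3P[_ _ /eqP] := valP p; rewrite sumnE (big_nth 0%N) big_mkord.
rewrite (big_ord_widen n (nth 0%N (val p))) ?intpart_size_le // => sum_n.
rewrite -[RHS]sum_n (bigID (fun i : 'I_n => (i < size (val p))%N)) /=.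
rewrite [X in (_ + X)%N]big1 ?addn0 // => i; rewrite -leqNgt; exact: nth_default.
Qed.

Lemma card_ord_lt m : (m <= n)%N -> #|[set i : 'I_n | i < m]| = m.
Proof.
move=> mn; rewrite -sum1dep_card -(big_ord_widen n (fun=> 1%N)) //.
by rewrite sum1_card card_ord.
Qed.

Lemma card_cells p : #|cells p| = n.
Proof.
rewrite -[RHS](sum_parts p) -sum1dep_card big_mkcond /=.
rewrite -(pair_bigA _ (fun i j : 'I_n => if j < nth 0 (val p) i then 1 else 0)) /=.
apply: eq_bigr => i _; rewrite -big_mkcond sum1dep_card.
by rewrite card_ord_lt ?intpart_part_le.
Qed.

Lemma tableau_inj p t : is_tableau p t -> injective t.
Proof. by case/andP=> /injectiveP. Qed.

Lemma tableau_range p t : is_tableau p t -> [set t x | x in [set: 'I_n]] = cells p.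
Proof.
move=> t_tab; have /andP[_ /forallP t_cell] := t_tab.
apply/eqP; rewrite eqEcard card_cells card_imset ?cardsT ?card_ord ?leqnn ?andbT.
  by apply/fintype.subsetP=> c /imsetP[x _ ->]; rewrite inE.
exact: tableau_inj t_tab.
Qed.

Lemma tableau_onto p t c : is_tableau p t -> c \in cells p -> exists x, t x = c.
Proof. by move=> /tableau_range <- /imsetP[x _ ->]; exists x. Qed.

Lemma tableau_exists p : exists t, is_tableau p t.
Proof.
exists [ffun x => enum_val (cast_ord (esym (card_cells p)) x)].
apply/andP; split.
  by apply/injectiveP=> x y; rewrite !ffunE => /enum_val_inj/cast_ord_inj.
apply/forallP=> x; rewrite ffunE.
by have := enum_valP (cast_ord (esym (card_cells p)) x); rewrite inE.
Qed.

(** Choosing preimages under [g] of the values of [f] gives an injective self-map of a finite set,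
    hence a permutation. *)
Lemma perm_of_factor (T : Type) (f g : 'I_n -> T) : injective f ->
  (forall x, exists y, g y = f x) -> exists s : 'S_n, forall x, g (s x) = f x.
Proof.
move=> f_inj /fin_all_exists[h gh].
have h_inj : injective h by move=> x y hxy; apply: f_inj; rewrite -!gh hxy.
by exists (perm h_inj) => x; rewrite permE.
Qed.

Lemma tableau_trans p t u : is_tableau p t -> is_tableau p u ->
  exists s, u = tableau_act s t.
Proof.
move=> t_tab u_tab; have [|s ts] := @perm_of_factor _ u t (tableau_inj u_tab).
  move=> x; apply: tableau_onto t_tab _; have /andP[_ /forallP/(_ x)] := u_tab.
  by rewrite inE.
by exists s; apply/ffunP=> x; rewrite ffunE ts.
Qed.

(** As [j] varies these are the partial sums of the row sizes of [w], so pointwise comparison of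
    [below] is the dominance order. *)
Definition below w j := #|[set x | w x < j]|.

Lemma below_col w (c : 'I_n -> 'I_n) j :
  below w j = \sum_(k < n) #|[set x | (c x == k) && (w x < j)]|.
Proof.
rewrite /below -sum1dep_card (partition_big c predT) //=; apply: eq_bigr => k _.
by rewrite sum1dep_card; apply: eq_card => x; rewrite !inE andbC.
Qed.

(* The sets compared are the entries of column k of t in the first j rows of w
   and of t; the right-hand one has min(j, height of column k) elements. *)
Lemma column_card_le p t w j k : is_tableau p t ->
  injective (fun x => (w x, (t x).2)) ->
  #|[set x | ((t x).2 == k) && (w x < j)]| <=
  #|[set x | ((t x).2 == k) && (tabloid t x < j)]|.
Proof.
move=> t_tab w_inj.
(* If column [k] of [t] ends before row [j], the right-hand set is the whole column. Otherwise both
   cardinals are compared with [j]: [w] is injective on the column, and its cells in the rows before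
   [j] all belong to the shape because the parts weakly decrease. *)
have [/forallP all_lt|/forallPn[y]] :=
  boolP [forall x, ((t x).2 == k) ==> ((t x).1 < j)].
  apply/subset_leq_card/fintype.subsetP=> x; rewrite !inE ffunE => /andP[xk _].
  by have := all_lt x; rewrite xk.
rewrite negb_imply -leqNgt => /andP[/eqP yk jy].
have jn : j <= n by apply: leq_trans jy (ltnW (ltn_ord _)).
apply: (@leq_trans j).
  rewrite -[X in _ <= X](card_ord_lt jn) -(card_in_imset (f := w)).
    by apply/subset_leq_card/fintype.subsetP=> i /imsetP[x]; rewrite !inE => /andP[_ ?] ->.
  move=> x z; rewrite !inE => /andP[/eqP xk _] /andP[/eqP zk _] wxz.
  by apply: w_inj; rewrite wxz xk zk.
rewrite -[X in X <= _](card_ord_lt jn) -[X in _ <= X](card_in_imset (f := fun x => (t x).1)).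
  apply/subset_leq_card/fintype.subsetP=> i; rewrite inE => ij.
  have [|x tx] := @tableau_onto p t (i, k) t_tab.
    rewrite inE /= -yk; have /andP[_ /forallP/(_ y) lt_y] := t_tab.
    apply: leq_trans lt_y _.
    have /and3P[p_dec _ _] := valP p.
    have [lt_size|?] := ltnP (t y).1 (size (val p)); last first.
      by rewrite nth_default.
    have ij_y : (i <= (t y).1)%N by lia.
    apply: (sorted_leq_nth _ _ 0 p_dec); rewrite ?inE //.
    + by move=> a b c /= ba cb; apply: leq_trans cb ba.
    + exact: leqnn.
    + exact: leq_ltn_trans ij_y lt_size.
  by apply/imsetP; exists x; rewrite ?inE ?ffunE tx ?eqxx.
move=> x z; rewrite !inE => /andP[/eqP xk _] /andP[/eqP zk _] txz.
apply: (tableau_inj t_tab); move: xk zk txz.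
by case: (t x) (t z) => [a b] [c d] /= -> -> ->.
Qed.

(** Entries sharing a column of [t] lie in different rows of [w], so the comparison holds column by
    column; summing over the columns gives dominance. *)
Lemma below_le p t w j : is_tableau p t -> injective (fun x => (w x, (t x).2)) ->
  below w j <= below (tabloid t) j.
Proof.
move=> t_tab w_inj; rewrite (below_col w (fun x => (t x).2)).
rewrite (below_col (tabloid t) (fun x => (t x).2)); apply: leq_sum => k _.
exact: column_card_le t_tab w_inj.
Qed.

(** Equality of the sums in [below_le] forces equality in every column. Subtracting consecutive
    levels, each column of [t] meets each row equally often for [w] and for [t], so every pair of
    [w x] and the column of [x] is a cell of [t]. *)
Lemma column_perm p t w : is_tableau p t -> injective (fun x => (w x, (t x).2)) ->
    below w =1 below (tabloid t) ->
  exists2 s, column_stabiliser t s & w = word_act s (tabloid t).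
Proof.
move=> t_tab w_inj wt.
have eq_col j k : #|[set x | ((t x).2 == k) && (w x < j)]| =
                  #|[set x | ((t x).2 == k) && (tabloid t x < j)]|.
  have := wt j; rewrite (below_col w (fun x => (t x).2)).
  rewrite (below_col (tabloid t) (fun x => (t x).2)).
  move/eqP; rewrite eqn_leq => /andP[_ le_sum].
  apply/eqP; rewrite eqn_leq (column_card_le _ _ t_tab w_inj) /=.
  rewrite leqNgt; apply/negP=> lt_k; move: le_sum; rewrite leqNgt => /negP; apply.
  rewrite (bigD1 k) //= [X in _ < X](bigD1 k) //= -addSn leq_add //.
  by apply: leq_sum => i _; exact: column_card_le t_tab w_inj.
have eq_lvl (v : 'I_n -> 'I_n) j k :
    #|[set x | ((t x).2 == k) && (v x < j.+1)]| =
    #|[set x | ((t x).2 == k) && (v x < j)]| + #|[set x | ((t x).2 == k) && (v x == j :> nat)]|.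
  rewrite -[in RHS]cardsUI [X in _ = _ + X](_ : _ = 0) ?addn0; last first.
    apply: eq_card0 => x; rewrite !inE; case: (_ == k) => //=.
    by case: ltngtP.
  by apply: eq_card => x; rewrite !inE; case: (_ == k) => //=; rewrite ltnS leq_eqVlt orbC.
have [|s ts] := @perm_of_factor _ (fun x => (w x, (t x).2)) t w_inj.
  move=> x; have := eq_lvl w (w x) (t x).2.
  rewrite !eq_col (eq_lvl (tabloid t)) => /addnI eq_x.
  have : 0 < #|[set y | ((t y).2 == (t x).2) && (tabloid t y == w x :> nat)]|.
    by rewrite eq_x; apply/card_gt0P; exists x; rewrite !inE !eqxx.
  case/card_gt0P=> y; rewrite inE ffunE => /andP[/eqP y2 /eqP/val_inj y1].
  by exists y; rewrite -y1 -y2; case: (t y).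
exists s; first by apply/forallP=> x; rewrite ts.
by apply/ffunP=> x; rewrite !ffunE ts.
Qed.

Lemma below_tableau p t j : is_tableau p t ->
  below (tabloid t) j = \sum_(i < n | i < j) nth 0 (val p) i.
Proof.
move=> t_tab; rewrite /below -(card_imset _ (tableau_inj t_tab)).
transitivity #|[set c : 'I_n * 'I_n | (c.1 < j) && (c.2 < nth 0 (val p) c.1)]|.
  apply: eq_card => c; rewrite inE; apply/imsetP/andP.
    case=> x; rewrite inE ffunE => xj ->; split=> //.
    by have /andP[_ /forallP] := t_tab; apply.
  case=> cj c_in; have [|x tx] := @tableau_onto p t c t_tab; first by rewrite inE.
  by exists x; rewrite // inE ffunE tx.
rewrite -sum1dep_card.
rewrite -(pair_big_dep (fun i : 'I_n => i < j)
  (fun i k : 'I_n => k < nth 0 (val p) i) (fun _ _ => 1)) /=.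
by apply: eq_bigr => i _; rewrite sum1dep_card card_ord_lt ?intpart_part_le.
Qed.

(** Differences of consecutive partial sums recover the row lengths. As the parts of a partition are
    nonzero, the lists also have the same length. This is the antisymmetry of dominance. *)
Lemma below_tableau_inj p q t u : is_tableau p t -> is_tableau q u ->
  below (tabloid t) =1 below (tabloid u) -> p = q.
Proof.
move=> t_tab u_tab tu.
have eq_nth i : nth 0 (val p) i = nth 0 (val q) i.
  have [lt_in|le_ni] := ltnP i n; last first.
    by rewrite !nth_default // (leq_trans (intpart_size_le _)).
  have := tu i.+1; have := tu i.
  rewrite !(below_tableau _ t_tab) !(below_tableau _ u_tab).
  have split_last (r : intpart n) : \sum_(k < n | k < i.+1) nth 0 (val r) k =
      nth 0 (val r) i + \sum_(k < n | k < i) nth 0 (val r) k.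
    rewrite (bigD1 (Ordinal lt_in)) //=; congr addn; apply: eq_bigl => k.
    by rewrite -val_eqE /= ltnS andbC ltn_neqAle.
  by rewrite !split_last => -> /addIn.
have size_eq (r : intpart n) m : (m < size (val r)) = (0 < nth 0 (val r) m).
  have [lt_m|le_m] := ltnP m (size (val r)); last by rewrite nth_default.
  rewrite lt0n; apply/esym; have /and3P[_ r0 _] := valP r.
  by apply: contraNneq r0 => <-; apply: mem_nth.
have size_pq : size (val p) = size (val q).
  apply/eqP; rewrite eqn_leq; apply/andP; split; rewrite leqNgt size_eq.
    by rewrite eq_nth -size_eq ltnn.
  by rewrite -eq_nth -size_eq ltnn.
by apply/val_inj/(eq_from_nth (x0 := 0)).
Qed.

End Tableaux.

Section CycleType.
Variable n : nat.
Implicit Types (s t : 'S_n) (x y : 'I_n).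

(** Equality of points on an orbit becomes congruence of exponents modulo the orbit length, so it
    can be carried over to an orbit of the same length of another permutation. *)
Lemma perm_iter_eq s x i j :
  ((s ^+ i)%g x == (s ^+ j)%g x) = (i == j %[mod #|porbit s x|]).
Proof.
set m := #|porbit s x|; have m0 : 0 < m by rewrite lt0n card_porbit_neq0.
have iter_mul k : iter (k * m) s x = x.
  by elim: k => // k IH; rewrite mulSn iterD IH iter_porbit.
have modE k : (s ^+ k)%g x = nth x (traject s x m) (k %% m).
  rewrite nth_traject ?ltn_pmod // permX {1}(divn_eq k m) addnC iterD iter_mul //.
by rewrite !modE nth_uniq ?size_traject ?ltn_pmod ?uniq_traject_porbit.
Qed.

(** Listing the orbits by decreasing size makes the sizes a partition, and lets the orbits of two
    permutations of the same cycle type be matched by index. *)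
Definition sorted_porbits s : seq {set 'I_n} :=
  sort (relpre (fun B : {set 'I_n} => #|B|) geq) (enum (porbits s)).

Lemma mem_sorted_porbits s B : (B \in sorted_porbits s) = (B \in porbits s).
Proof. by rewrite mem_sort mem_enum. Qed.

Lemma sorted_porbits_uniq s : uniq (sorted_porbits s).
Proof. by rewrite sort_uniq enum_uniq. Qed.

Lemma porbits_card_sum s : \sum_(B in porbits s) #|B| = n.
Proof.
rewrite -[RHS](card_ord n) -sum1_card (partition_big_imset (porbit s)) /=.
apply: eq_bigr => _ /imsetP[x _ ->]; rewrite -sum1_card; apply: eq_bigl => y.
by rewrite eq_porbit_mem.
Qed.

Lemma cycle_type_is_intpart s :
  is_intpart n [seq #|B| | B : {set 'I_n} <- sorted_porbits s].
Proof.
apply/and3P; split.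
- rewrite sorted_map; apply: sort_sorted => A B /=; exact: leq_total.
- apply/mapP=> -[B]; rewrite mem_sorted_porbits => /imsetP[x _ ->] /eqP.
  by rewrite eq_sym (negbTE (card_porbit_neq0 s x)).
- rewrite sumnE big_map (perm_big _ (permEl (perm_sort _ _))) /= big_enum.
  exact/eqP/porbits_card_sum.
Qed.

Definition cycle_type s : intpart n := exist (is_intpart n) _ (cycle_type_is_intpart s).

(** The conjugating permutation matches orbits of [s] with orbits of [t] of the same size, fixes a
    base point in each, and sends the [k]-th iterate of one base point to the [k]-th iterate of the
    other. *)
Lemma cycle_type_conj s t : cycle_type s = cycle_type t -> exists g, t = (s ^ g)%g.
Proof.
move/(congr1 val) => /= eq_card.
have eq_size : size (sorted_porbits s) = size (sorted_porbits t).
  by have := congr1 size eq_card; rewrite !size_map.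
pose beta B := nth finset.set0 (sorted_porbits t) (index B (sorted_porbits s)).
have betaP x : exists y, beta (porbit s x) = porbit t y.
  have : beta (porbit s x) \in sorted_porbits t.
    by rewrite mem_nth // -eq_size index_mem mem_sorted_porbits imset_f.
  by rewrite mem_sorted_porbits => /imsetP[y _ ->]; exists y.
have beta_card x : #|beta (porbit s x)| = #|porbit s x|.
  have xs : porbit s x \in sorted_porbits s by rewrite mem_sorted_porbits imset_f.
  have := congr1 (nth 0 ^~ (index (porbit s x) (sorted_porbits s))) eq_card.
  rewrite /= !(nth_map finset.set0) ?index_mem // -?eq_size ?index_mem //.
  by rewrite nth_index.
have beta_inj x y : beta (porbit s x) = beta (porbit s y) -> porbit s x = porbit s y.
  have mem_s z : porbit s z \in sorted_porbits s by rewrite mem_sorted_porbits imset_f.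
  move/eqP; rewrite nth_uniq ?sorted_porbits_uniq -?eq_size ?index_mem //.
  by move/eqP/(congr1 (nth finset.set0 (sorted_porbits s))); rewrite !nth_index.
(* The default [x] only makes [rep] total: on a nonempty set the picked point depends on the set
   alone, as [rep_eq] records. *)
pose rep B : 'I_n -> 'I_n := fun x => odflt x [pick y in B : {set 'I_n}].
have repP (B : {set 'I_n}) x : x \in B -> rep B x \in B.
  by move=> xB; rewrite /rep; case: pickP => [//|/(_ x)]; rewrite xB.
have rep_eq (B : {set 'I_n}) x y : x \in B -> rep B x = rep B y.
  by move=> xB; rewrite /rep; case: pickP => [//|/(_ x)]; rewrite xB.
have [k kP] : exists k : 'I_n -> nat, forall x, x = (s ^+ k x)%g (rep (porbit s x) x).
  apply: (@fin_all_exists _ _ (fun x i => x = (s ^+ i)%g (rep (porbit s x) x))) => x.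
  by apply/porbitP; rewrite porbit_sym repP ?porbit_id.
pose r x := rep (porbit s x) x.
pose r' x := rep (beta (porbit s x)) x.
have r_orb x : porbit s (r x) = porbit s x.
  by apply/eqP; rewrite eq_porbit_mem repP ?porbit_id.
have r'_orb x : porbit t (r' x) = beta (porbit s x).
  have [y yE] := betaP x; rewrite /r' yE; apply/eqP; rewrite eq_porbit_mem.
  rewrite (_ : rep _ x = rep (porbit t y) y) ?repP ?porbit_id //.
  by apply/esym/rep_eq/porbit_id.
have r_const x y : porbit s x = porbit s y -> r x = r y.
  by move=> xy; rewrite /r -xy; apply: rep_eq; rewrite porbit_id.
have r'_const x y : porbit s x = porbit s y -> r' x = r' y.
  move=> xy; rewrite /r' -xy; have [z ->] := betaP x.
  by rewrite -(rep_eq _ z) ?porbit_id // -(rep_eq _ z y) ?porbit_id.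
pose h x := (t ^+ k x)%g (r' x).
(* Matched orbits have the same length, so iterates of the base points coincide for [t] exactly when
   they do for [s]. This gives both the injectivity of [h] and the conjugation identity. *)
have step x y i j : porbit s x = porbit s y ->
    ((t ^+ i)%g (r' x) == (t ^+ j)%g (r' y)) = ((s ^+ i)%g (r x) == (s ^+ j)%g (r y)).
  move=> xy; rewrite -(r'_const x y xy) -(r_const x y xy) !perm_iter_eq.
  by rewrite r'_orb r_orb beta_card.
have h_inj : injective h.
  move=> x y hxy; have xy : porbit s x = porbit s y.
    apply: beta_inj; rewrite -!r'_orb -[LHS](porbit_perm t (k x)).
    by rewrite [X in porbit t X]hxy porbit_perm.
  by rewrite (kP x) (kP y); apply/eqP; rewrite -step //; apply/eqP.
exists (perm h_inj); apply/permP=> y; rewrite -[y](permKV (perm h_inj)).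
move: ((perm h_inj)^-1%g y) => x; rewrite conjgE !permM permK !permE.
have sx : porbit s x = porbit s (s x) by rewrite -[in RHS](expg1 s) porbit_perm.
have -> : t (h x) = (t ^+ (k x).+1)%g (r' x) by rewrite expgSr permM.
apply/eqP; rewrite step // -[X in _ == X]kP expgSr permM; apply/eqP; congr (s _).
by rewrite -kP.
Qed.

End CycleType.

Import GRing.Theory Num.Theory.
Local Open Scope ring_scope.
Local Open Scope classical_set_scope.

(** * Specht modules *)

Section GroupAlgebraTheory.
Variables (F : fieldType) (n : nat).
Local Notation A := (symalg F n).
Implicit Types (a b : A) (s : 'S_n) (t : tableau n) (w : word n) (f : wordmod F n).

Definition symelt s : A := grpalg_elt F s.

Lemma symeltM s s' : symelt (s * s')%g = symelt s * symelt s'.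
Proof. by rewrite [RHS]grpalg_eltM. Qed.

Lemma symelt1 : symelt 1%g = 1. Proof. by []. Qed.

Lemma symalg_mulE a b s : (a * b) s = \sum_r a r * b (r^-1 * s)%g.
Proof. by rewrite ffunE. Qed.

Lemma symalg_addE a b s : (a + b) s = a s + b s.
Proof. by rewrite ffunE. Qed.

Lemma symalg_scaleE k a s : (k *: a) s = k * a s.
Proof. by rewrite ffunE. Qed.

Lemma wordmod_scaleE a f w :
  (a *: f) w = \sum_s a s * f (word_act s^-1%g w).
Proof. by rewrite ffunE. Qed.

Lemma wordmod_algE (k : F) f w : (k%:A *: f) w = k * f w.
Proof.
rewrite wordmod_scaleE (bigD1 1%g) //= big1 => [|s /negbTE ns].
  by rewrite !ffunE eqxx mulr1 invg1 word_act1 addr0.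
by rewrite !ffunE ns mulr0 mul0r.
Qed.

Lemma wordmod_symeltE s f w : (symelt s *: f) w = f (word_act s^-1%g w).
Proof.
rewrite wordmod_scaleE (bigD1 s) //= big1 => [|r /negbTE ns].
  by rewrite !ffunE eqxx mul1r addr0.
by rewrite !ffunE ns mul0r.
Qed.

Lemma wordmod_symelt_act s w : symelt s *: wordmod_elt F w = wordmod_elt F (word_act s w).
Proof. exact: wordmod_eltZ. Qed.

Lemma wordmod_sum f : f = \sum_w (f w)%:A *: wordmod_elt F w.
Proof.
apply/ffunP=> w; rewrite sum_ffunE (bigD1 w) //= big1 => [|u /negbTE nu].
  by rewrite wordmod_algE ffunE eqxx mulr1 addr0.
by rewrite wordmod_algE ffunE eq_sym nu mulr0.
Qed.

Lemma symalg_sum a : a = \sum_s (a s)%:A * symelt s.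
Proof. exact: grpalg_sum. Qed.

Definition colsum t : A := \sum_(s | column_stabiliser t s) (-1) ^+ s * symelt s.

Definition row_stabiliser t : pred 'S_n :=
  [pred s : 'S_n | [forall x, (t (s x)).1 == (t x).1]].

Definition rowsum t : A := \sum_(s | row_stabiliser t s) symelt s.

Lemma polytabloidE t : polytabloid F t = colsum t *: wordmod_elt F (tabloid t).
Proof.
by rewrite /colsum scaler_suml; apply: eq_bigr => s _; rewrite -scalerA.
Qed.

Lemma column_stabiliserM t s r : column_stabiliser t s ->
  column_stabiliser t (s * r)%g = column_stabiliser t r.
Proof.
move=> /forallP s_col; apply/forallP/forallP=> r_col x; last first.
  by rewrite permM (eqP (r_col _)) s_col.
have := r_col (s^-1%g x); rewrite permM permKV => /eqP->.
by have := s_col (s^-1%g x); rewrite permKV eq_sym.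
Qed.

Lemma column_stabiliserV t s : column_stabiliser t s^-1%g = column_stabiliser t s.
Proof.
by apply/forallP/forallP=> s_col x; [have := s_col (s x) | have := s_col (s^-1%g x)];
  rewrite ?permK ?permKV eq_sym.
Qed.

Lemma column_stabiliserMr t s r : column_stabiliser t s ->
  column_stabiliser t (r * s)%g = column_stabiliser t r.
Proof.
by move=> s_col; rewrite -column_stabiliserV invMg column_stabiliserM column_stabiliserV.
Qed.

Lemma row_stabiliserM t s r : row_stabiliser t s ->
  row_stabiliser t (r * s)%g = row_stabiliser t r.
Proof.
by move=> /forallP s_row; apply/forallP/forallP=> r_row x; have := r_row x;
  rewrite permM (eqP (s_row _)).
Qed.

Lemma row_stabiliserV t s : row_stabiliser t s^-1%g = row_stabiliser t s.
Proof.
by apply/forallP/forallP=> s_col x; [have := s_col (s x) | have := s_col (s^-1%g x)];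
  rewrite ?permK ?permKV eq_sym.
Qed.

Lemma symelt_colsum t s : column_stabiliser t s ->
  symelt s * colsum t = (-1) ^+ s * colsum t.
Proof.
move=> s_col; rewrite /colsum !mulr_sumr [RHS](reindex_inj (mulgI s)) /=.
apply: eq_big => [r|r _]; first by rewrite column_stabiliserM.
rewrite odd_permM mulrA -signr_addb addbA addbb addFb symeltM.
rewrite mulrA -signr_odd; case: odd;
  by rewrite ?expr1 ?expr0 ?mulrN1 ?mulN1r ?mulr1 ?mul1r // mulNr.
Qed.

Lemma colsum_symelt t s : column_stabiliser t s ->
  colsum t * symelt s = (-1) ^+ s * colsum t.
Proof.
move=> s_col; rewrite /colsum mulr_suml mulr_sumr [RHS](reindex_inj (mulIg s)) /=.
apply: eq_big => [r|r _]; first by rewrite column_stabiliserMr.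
by rewrite odd_permM !mulrA -signr_addb addbC addbK symeltM mulrA.
Qed.

Lemma rowsum_symelt t s : row_stabiliser t s -> rowsum t * symelt s = rowsum t.
Proof.
move=> s_row; rewrite /rowsum mulr_suml [RHS](reindex_inj (mulIg s)) /=.
by apply: eq_big => [r|r _]; rewrite ?row_stabiliserM // symeltM.
Qed.

End GroupAlgebraTheory.

Lemma alg_scalerCA (F : fieldType) (B : algType F) (V : lmodType B) (k : F) (a : B) (v : V) :
  a *: (k%:A *: v) = k%:A *: (a *: v).
Proof. by rewrite !scalerA mulr_algr mulr_algl. Qed.

Section SpechtSimple.
Variables (C : numClosedFieldType) (n : nat).
Local Notation A := (symalg C n).
Implicit Types (a b : A) (s : 'S_n) (t u : tableau n) (w : word n) (f : wordmod C n).
Implicit Types (p q : intpart n).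

Lemma below_act s w : below (word_act s w) =1 below w.
Proof.
move=> j; rewrite /below -[RHS](card_preimset _ (@perm_inj _ s)).
by apply: eq_card => x; rewrite !inE ffunE.
Qed.

Lemma wordmod_signE (b : bool) f w : (((-1) ^+ b : A) *: f) w = (-1) ^+ b * f w.
Proof. by case: b; rewrite ?scale1r ?mul1r // scaleN1r mulN1r ffunE. Qed.

Lemma wordmod_eqN0 f : f = - f -> f = 0.
Proof.
move=> fN; apply/ffunP=> w; have /ffunP/(_ w) := fN; rewrite !ffunE => /eqP.
by rewrite -addr_eq0 -mulr2n mulrn_eq0 => /eqP.
Qed.

Lemma tperm_colsum t x y : x != y -> (t x).2 = (t y).2 ->
  colsum C t * symelt C (tperm x y) = - colsum C t.
Proof.
move=> xy txy; rewrite colsum_symelt ?odd_tperm ?xy ?expr1 ?mulN1r //.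
by apply/forallP=> z; case: tpermP => [->|->|//]; rewrite txy.
Qed.

(** The transposition of two entries lying in one column of [t] and one row of [w] fixes [w] and
    negates [colsum], so the product would equal its own opposite. *)
Lemma colsum_word_inj t w : colsum C t *: wordmod_elt C w != 0 ->
  injective (fun x => (w x, (t x).2)).
Proof.
move=> cw x y [wxy txy]; apply: contra_neq_eq cw => xy; apply: wordmod_eqN0.
rewrite -scaleNr -(tperm_colsum xy txy) -scalerA wordmod_symelt_act.
congr (_ *: wordmod_elt _ _); apply/ffunP=> z; rewrite ffunE.
by case: tpermP => [->|->|//].
Qed.

(* The support condition says that f lies in the permutation module M^p. *)
Definition in_permmod t f := forall w, f w != 0 -> below w =1 below (tabloid t).

(** A word of [f] not killed by [colsum] is, by [column_perm], a column permutation of the tabloid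
    of [t], and [colsum] absorbs that permutation up to sign. *)
Lemma colsum_permmod p t f : is_tableau p t -> in_permmod t f ->
  exists k : C, colsum C t *: f = k%:A *: polytabloid C t.
Proof.
move=> t_tab f_t; pose P g := exists k : C, g = k%:A *: polytabloid C t.
have P0 : P 0 by exists 0; rewrite !scale0r.
rewrite [f]wordmod_sum scaler_sumr; elim/big_ind: _ => // [x y [k ->] [l ->]|w _].
  by exists (k + l); rewrite !scalerDl.
have [->|fw] := eqVneq (f w) 0; first by rewrite !scale0r scaler0.
have [cw|cw] := eqVneq (colsum C t *: wordmod_elt C w) 0.
  by rewrite alg_scalerCA cw scaler0.
have [s s_col ws] := column_perm t_tab (colsum_word_inj cw) (f_t w fw).
exists (f w * (-1) ^+ s); rewrite alg_scalerCA.
rewrite [X in colsum _ _ *: wordmod_elt _ X]ws -wordmod_symelt_act.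
rewrite (scalerA (colsum C t)) colsum_symelt //.
rewrite -scalerA -polytabloidE scalerA; congr (_ *: _).
rewrite mulr_algl.
by case: (odd_perm s); rewrite ?expr0 ?expr1 ?mulr1 ?mulrN1 ?scalerN ?scaleNr.
Qed.

Lemma polytabloid_valE t w :
  polytabloid C t w = \sum_(s | column_stabiliser t s)
    (-1) ^+ s * (w == word_act s (tabloid t))%:R.
Proof.
rewrite /polytabloid sum_ffunE; apply: eq_bigr => s _.
by rewrite wordmod_signE [grpalg_elt _ _ *: _]wordmod_symelt_act ffunE.
Qed.

Lemma polytabloid_permmod t : in_permmod t (polytabloid C t).
Proof.
move=> w; rewrite polytabloid_valE => w_t.
have [s /eqP->|no_s] := pickP (fun s => w == word_act s (tabloid t)).
  exact: below_act.
by rewrite big1 ?eqxx // in w_t => s _; rewrite no_s mulr0.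
Qed.

(** Inversion preserves the column stabiliser and signs, so this coordinate is the bilinear pairing
    of [f] with the polytabloid. It turns vanishing under [colsum] into orthogonality. *)
Lemma colsum_valE t f :
  (colsum C t *: f) (tabloid t) = \sum_w polytabloid C t w * f w.
Proof.
transitivity (\sum_(s | column_stabiliser t s) (-1) ^+ s * f (word_act s (tabloid t))).
  rewrite /colsum scaler_suml sum_ffunE (reindex_inj invg_inj) /=.
  apply: eq_big => s; first by rewrite column_stabiliserV.
  rewrite odd_permV -scalerA => _.
  by rewrite wordmod_signE wordmod_symeltE invgK.
under [RHS]eq_bigr => w _ do rewrite polytabloid_valE mulr_suml.
rewrite exchange_big /=; apply: eq_bigr => s _.
rewrite (bigD1 (word_act s (tabloid t))) //= eqxx mulr1 big1 ?addr0 //.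
by move=> w /negbTE->; rewrite mulr0 mul0r.
Qed.

(** The row and column stabilisers of [t] meet trivially, since row and column together determine an
    entry. Hence a tabloid has coefficient 1 in its own polytabloid. *)
Lemma word_act_tabloid_inj t s : injective t -> column_stabiliser t s ->
  word_act s (tabloid t) = tabloid t -> s = 1%g.
Proof.
move=> t_inj /forallP s_col /ffunP s_tab; apply/permP=> x; rewrite perm1.
apply: t_inj; move: (s_tab x) (s_col x); rewrite !ffunE => + /eqP.
by case: (t _) (t _) => a b [c d] /= -> ->.
Qed.

Lemma polytabloid_tabloid t : injective t -> polytabloid C t (tabloid t) = 1.
Proof.
move=> t_inj; rewrite polytabloid_valE (bigD1 1%g) /=; last first.
  by apply/forallP=> x; rewrite perm1.
rewrite word_act1 eqxx odd_perm1 expr0 mulr1 big1 ?addr0 // => s /andP[s_col s1].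
case: eqP => [st|]; rewrite ?mulr0 //.
by case/eqP: s1; exact: word_act_tabloid_inj t_inj s_col (esym st).
Qed.

Lemma polytabloid_neq0 p t : is_tableau p t -> polytabloid C t != 0.
Proof.
move/tableau_inj/polytabloid_tabloid=> e1; apply: contra_eq_neq e1 => ->.
by rewrite ffunE eq_sym oner_eq0.
Qed.

Lemma specht_permmod p t f : is_tableau p t -> specht_set p f -> in_permmod t f.
Proof.
move=> t_tab [c ->] w; rewrite sum_ffunE => fw.
have [u /andP[u_tab uw]|no_u] := pickP (fun u => is_tableau p u && (polytabloid C u w != 0)).
  move=> j; rewrite (polytabloid_permmod uw) (below_tableau _ u_tab).
  by rewrite (below_tableau _ t_tab).
rewrite big1 ?eqxx // in fw => u u_tab; have := no_u u.
by rewrite u_tab /= => /negbFE/eqP; rewrite wordmod_algE => ->; rewrite mulr0.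
Qed.

Lemma specht_cyclic p t f : is_tableau p t -> specht_set p f ->
  exists a : A, f = a *: polytabloid C t.
Proof.
move=> t_tab [c ->]; elim/big_ind: _ => [|x y [a ->] [b ->]|u u_tab].
- by exists 0; rewrite scale0r.
- by exists (a + b); rewrite scalerDl.
- have [s ->] := tableau_trans t_tab u_tab.
  by exists ((c (tableau_act s t))%:A * symelt C s); rewrite -scalerA polytabloid_act.
Qed.

Lemma polytabloid_specht p t : is_tableau p t -> specht_set p (polytabloid C t).
Proof.
move=> t_tab; exists (fun u => (u == t)%:R); rewrite (bigD1 t) //= eqxx.
rewrite scale1r scale1r big1 ?addr0 // => u /andP[_ /negbTE->].
by rewrite !scale0r.
Qed.

(* Polytabloids have integer coordinates, so the conjugate of f is also in the
   span of the polytabloids, to which f is orthogonal. *)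
Lemma specht_eq0 p f : specht_set p f ->
  (forall t, is_tableau p t -> colsum C t *: f = 0) -> f = 0.
Proof.
move=> [c f_c] f_col; have f_orth : \sum_w f w * (f w)^* = 0.
  under eq_bigr => w _ do rewrite [in X in _ * X]f_c sum_ffunE rmorph_sum mulr_sumr.
  rewrite exchange_big big1 //= => t t_tab.
  have /ffunP/(_ (tabloid t)) := f_col t t_tab; rewrite colsum_valE ffunE.
  move/(congr1 ( *%R (c t)^*)); rewrite mulr0 mulr_sumr => {2}<-.
  apply: eq_bigr => w _; rewrite wordmod_algE rmorphM mulrC -mulrA; congr (_ * (_ * _)).
  rewrite polytabloid_valE rmorph_sum; apply: eq_bigr => s _.
  by rewrite rmorphM rmorph_nat rmorphXn rmorphN1.
apply/ffunP=> w; rewrite ffunE; apply/eqP; rewrite -normr_eq0 -sqrf_eq0 normCK.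
have /psumr_eq0P-> // := f_orth => u _; rewrite -normCK; exact: exprn_ge0.
Qed.

(** Some word of [f] survives [colsum]. It has the row sizes of [q] because [f] lies in the
    permutation module, and [below_le] applies to it. *)
Lemma colsum_specht_dominance p q t u f : is_tableau p t -> is_tableau q u ->
  specht_set q f -> colsum C t *: f != 0 ->
  forall j, (below (tabloid u) j <= below (tabloid t) j)%N.
Proof.
move=> t_tab u_tab f_q cf j.
have [w /andP[fw cw]|no_w] :=
  pickP (fun w => (f w != 0) && (colsum C t *: wordmod_elt C w != 0)).
  rewrite -(specht_permmod u_tab f_q fw); exact: below_le t_tab (colsum_word_inj cw).
case/eqP: cf; rewrite [f]wordmod_sum scaler_sumr big1 // => w _.
have := no_w w; have [->|/= fw] := eqVneq (f w) 0; first by rewrite !scale0r scaler0.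
by move/negbFE/eqP=> cw; rewrite alg_scalerCA cw scaler0.
Qed.

(** Each term of [colsum] acts on the polytabloid by the square of a sign, so the scalar is the
    order of the column stabiliser, which is nonzero in characteristic zero. *)
Lemma colsum_polytabloid t : exists2 m : nat, (0 < m)%N &
  colsum C t *: polytabloid C t = m%:R *: polytabloid C t.
Proof.
exists #|column_stabiliser t|.
  by apply/card_gt0P; exists 1%g; apply/forallP=> x; rewrite perm1.
rewrite {1}/colsum scaler_suml -sum1_card natr_sum scaler_suml; apply: eq_bigr => s s_col.
rewrite -scalerA polytabloidE [symelt _ _ *: _]scalerA symelt_colsum // -scalerA scalerA.
by rewrite -signr_addb addbb.
Qed.

End SpechtSimple.

Section LinearMaps.
Variables (B : pzRingType).
Implicit Types (U V W : lmodType B).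

Lemma linear_map0 V W (f : V -> W) : linear f -> f 0 = 0.
Proof. by move=> f_lin; have := f_lin (-1) 0 0; rewrite !scaleN1r !addNr. Qed.

Lemma linear_mapD V W (f : V -> W) : linear f -> {morph f : x y / x + y}.
Proof. by move=> f_lin x y; rewrite -[x]scale1r f_lin !scale1r. Qed.

Lemma linear_mapZ V W (f : V -> W) : linear f -> forall a x, f (a *: x) = a *: f x.
Proof. by move=> f_lin a x; rewrite -[a *: x]addr0 f_lin (linear_map0 f_lin) addr0. Qed.

Lemma linear_mapN V W (f : V -> W) : linear f -> forall x, f (- x) = - f x.
Proof. by move=> f_lin x; rewrite -scaleN1r (linear_mapZ f_lin) scaleN1r. Qed.

Lemma linear_comp V W U (f : V -> W) (g : W -> U) : linear f -> linear g -> linear (g \o f).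
Proof. by move=> f_lin g_lin a x y; rewrite /= f_lin g_lin. Qed.

Lemma preimage_submodule V W (f : V -> W) (X : set W) : linear f ->
  is_submodule X -> is_submodule (f @^-1` X).
Proof.
move=> f_lin [X0 XD]; split; first by rewrite /preimage /= (linear_map0 f_lin).
by move=> a u v Xu Xv; rewrite /preimage /= f_lin; apply: XD.
Qed.

Lemma zero_submodule V : is_submodule ([set 0] : set V).
Proof. by split=> // a u v /= -> ->; rewrite scaler0 addr0. Qed.

Lemma range_submodule V W (f : V -> W) : linear f -> is_submodule (range f).
Proof.
move=> f_lin; split; first by exists 0; rewrite ?(linear_map0 f_lin).
by move=> a _ _ [x _ <-] [y _ <-]; exists (a *: x + y); rewrite ?f_lin.
Qed.

Lemma linear_inj V W (f : V -> W) : linear f -> (forall x, f x = 0 -> x = 0) -> injective f.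
Proof.
move=> f_lin f0 x y fxy; apply/eqP; rewrite -subr_eq0; apply/eqP/f0.
by rewrite (linear_mapD f_lin) (linear_mapN f_lin) fxy subrr.
Qed.

Lemma simple_inj V W (f : V -> W) : simple_module V -> linear f ->
  (exists x, f x <> 0) -> injective f.
Proof.
move=> [_ V_simple] f_lin [x fx]; apply: (linear_inj f_lin) => y fy.
have [K0|KT] := V_simple _ (preimage_submodule f_lin (@zero_submodule W)).
  have : (f @^-1` [set 0]) y by [].
  by rewrite K0.
by have : (f @^-1` [set 0]) x by rewrite KT.
Qed.

Lemma simple_surj V W (f : V -> W) : simple_module W -> linear f ->
  (exists x, f x <> 0) -> forall y, exists x, f x = y.
Proof.
move=> [_ W_simple] f_lin [x fx] y.
have [R0|RT] := W_simple _ (range_submodule f_lin).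
  have : range f (f x) by exists x.
  by rewrite R0 => /fx.
have : range f y by rewrite RT.
by case=> z _ <-; exists z.
Qed.

End LinearMaps.

Section SpechtModules.
Variables (C : numClosedFieldType) (n : nat).
Local Notation A := (symalg C n).
Implicit Types (p q : intpart n) (t u : tableau n).

Lemma specht_valP p (x : specht C p) : specht_set p (val x).
Proof. by have := valP x => /set_mem. Qed.

Definition specht_sub p (v : wordmod C n) (v_p : specht_set p v) : specht C p :=
  Sub v (mem_set v_p).

Lemma specht_subK p v (v_p : specht_set p v) : val (specht_sub v_p) = v.
Proof. by []. Qed.

Lemma specht_valZ p (a : A) (x : specht C p) : val (a *: x) = a *: val x.
Proof. by []. Qed.

(** James' dichotomy for a submodule: if some [colsum] does not kill it, it contains a nonzero
    multiple of a polytabloid, which generates everything; otherwise all its elements vanish by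
    [specht_eq0]. *)
Lemma specht_simple p : simple_module (specht C p).
Proof.
have [t0 t0_tab] := tableau_exists p; split.
  move=> /seteqP[/(_ (specht_sub (polytabloid_specht C t0_tab)) I) /= e0 _].
  have := polytabloid_neq0 C t0_tab; apply/negP; rewrite negbK.
  by rewrite -(specht_subK (polytabloid_specht C t0_tab)) e0.
move=> U [U0 UD].
have [[x [t [Ux t_tab cx]]]|no_x] :=
  pselect (exists x t, [/\ U x, is_tableau p t & colsum C t *: val x <> 0]).
- right; apply/seteqP; split=> // y _.
  have [k ck] := colsum_permmod t_tab (specht_permmod t_tab (specht_valP x)).
  have k0 : k != 0.
    by apply/eqP=> k0; apply: cx; rewrite ck k0 !scale0r.
  have [a ya] := specht_cyclic t_tab (specht_valP y).
  suff -> : y = (a * k^-1%:A * colsum C t) *: x + 0 by apply: UD.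
  apply: val_inj; rewrite addr0 specht_valZ ya -!scalerA ck; congr (_ *: _).
  by rewrite scalerA mulr_algl scalerA mulVf // !scale1r.
- left; apply/seteqP; split=> [x Ux|x ->] //=; apply: val_inj.
  apply: (specht_eq0 (specht_valP x)) => t t_tab.
  by apply: contra_notP no_x => cx; exists x, t.
Qed.

(** Between simple modules [f] is bijective. As [colsum] does not kill its own polytabloid, it kills
    neither the image of that of [t] nor the preimage of that of [u]; so each shape dominates the
    other. *)
Lemma specht_hom_eq p q (f : specht C p -> specht C q) : linear f ->
  (exists x, f x <> 0) -> p = q.
Proof.
move=> f_lin f_neq0; have f_inj := simple_inj (specht_simple p) f_lin f_neq0.
have f_surj := simple_surj (specht_simple q) f_lin f_neq0.
have [t t_tab] := tableau_exists p; have [u u_tab] := tableau_exists q.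
have col_inv (r : intpart n) (v : tableau n) (v_tab : is_tableau r v) (x : specht C r) :
    val x = polytabloid C v -> colsum C v *: x <> 0.
  move=> xv cx; have : val (colsum C v *: x) = 0 by rewrite cx.
  rewrite [LHS]specht_valZ xv; apply/eqP.
  have [m m0 ->] := colsum_polytabloid C v; apply/eqP=> /ffunP/(_ (tabloid v)).
  rewrite scaler_nat ffunMnE polytabloid_tabloid ?ffunE; last exact: tableau_inj v_tab.
  by move/eqP; rewrite pnatr_eq0 eqn0Ngt m0.
pose x := specht_sub (polytabloid_specht C t_tab).
pose y := specht_sub (polytabloid_specht C u_tab).
have [z fz] := f_surj y.
apply: (below_tableau_inj t_tab u_tab) => j; apply/eqP; rewrite eqn_leq; apply/andP; split.
- apply: (colsum_specht_dominance u_tab t_tab (specht_valP z)) => //.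
  apply/eqP=> cz; apply: (col_inv q u u_tab y) => //.
  rewrite -fz -(linear_mapZ f_lin) -(linear_map0 f_lin); congr (f _).
  exact: val_inj.
- apply: (colsum_specht_dominance t_tab u_tab (specht_valP (f x))) => //.
  apply/eqP=> cfx; apply: (col_inv p t t_tab x) => //.
  apply: f_inj; rewrite (linear_mapZ f_lin) (linear_map0 f_lin); exact: val_inj.
Qed.

End SpechtModules.

(** * Completeness of the Specht modules *)

Section Center.
Variables (C : numClosedFieldType) (n : nat).
Local Notation A := (symalg C n).
Implicit Types (a b : A) (s g : 'S_n) (t u : tableau n) (p q : intpart n).

(** This is the adjoint on the group algebra: the coefficient of [a * star a] at the identity is the
    squared norm of [a], which is how elements are shown to be nonzero below. *)
Definition star a : A := [ffun s => (a s^-1%g)^*].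

Lemma starM a b : star (a * b) = star b * star a.
Proof.
apply/ffunP=> s; rewrite ffunE !symalg_mulE rmorph_sum /=.
rewrite [RHS](reindex_inj (mulgI s)) /=; apply: eq_bigr => r _.
by rewrite rmorphM !ffunE mulrC !invMg !invgK mulKg.
Qed.

Lemma starD a b : star (a + b) = star a + star b.
Proof. by apply/ffunP=> s; rewrite symalg_addE !ffunE rmorphD. Qed.

Lemma star0 : star 0 = 0.
Proof. by apply/ffunP=> s; rewrite !ffunE rmorph0. Qed.

Lemma starN a : star (- a) = - star a.
Proof. by apply/ffunP=> s; rewrite !ffunE rmorphN. Qed.

Lemma star_symelt s : star (symelt C s) = symelt C s^-1%g.
Proof.
apply/ffunP=> r; rewrite !ffunE -(inj_eq invg_inj) invgK.
by case: eqP => _; rewrite ?rmorph1 ?rmorph0.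
Qed.

Lemma star_rowsum t : star (rowsum C t) = rowsum C t.
Proof.
rewrite /rowsum (big_morph star starD star0) [RHS](reindex_inj invg_inj) /=.
by apply: eq_big => [s|s _]; rewrite ?row_stabiliserV // star_symelt.
Qed.

Lemma star_colsum t : star (colsum C t) = colsum C t.
Proof.
rewrite /colsum (big_morph star starD star0) [RHS](reindex_inj invg_inj) /=.
apply: eq_big => [s|s _]; first by rewrite column_stabiliserV.
by rewrite odd_permV; case: (odd_perm s); rewrite ?mulN1r ?mul1r ?starN star_symelt.
Qed.

Lemma mul_star1 a : (a * star a) 1%g = \sum_s `|a s| ^+ 2.
Proof.
rewrite symalg_mulE; apply: eq_bigr => s _.
by rewrite ffunE mulg1 invgK normCK.
Qed.

Lemma mul_star1_eq0 a : ((a * star a) 1%g == 0) = (a == 0).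
Proof.
apply/idP/eqP => [|->]; last by rewrite mul0r ffunE.
rewrite mul_star1 psumr_eq0; last by move=> s _; exact: exprn_ge0.
move=> /allP a0; apply/ffunP=> s; rewrite ffunE.
by have := a0 s (mem_index_enum s); rewrite /= sqrf_eq0 normr_eq0 => /eqP.
Qed.

Lemma symelt_conjE a s g : (symelt C g * a * symelt C g^-1%g) s = a (s ^ g)%g.
Proof.
rewrite -mulrA symalg_mulE (bigD1 g) //= big1 ?addr0 => [|r /negbTE ng].
  rewrite ffunE eqxx mul1r symalg_mulE (bigD1 (s ^ g)%g) //= big1 ?addr0.
    have -> : ((s ^ g)^-1 * (g^-1 * s) = g^-1)%g.
      by rewrite conjgE !invMg !invgK -!mulgA mulKVg mulVg mulg1.
    by rewrite ffunE eqxx mulr1.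
  move=> r /negbTE nr; rewrite ffunE; case: eqP => [e|_]; last by rewrite mulr0.
  suff e' : r = (s ^ g)%g by rewrite e' eqxx in nr.
  apply: invg_inj; apply: (mulIg (g^-1 * s)%g).
  by rewrite e conjgE !invMg !invgK -!mulgA mulKVg mulVg mulg1.
by rewrite ffunE ng mul0r.
Qed.

Definition conj_sum a : A := \sum_g symelt C g * a * symelt C g^-1%g.

Lemma conj_sumE a s : conj_sum a s = \sum_g a (s ^ g)%g.
Proof. by rewrite sum_ffunE; apply: eq_bigr => g _; rewrite symelt_conjE. Qed.

Lemma conj_sumJ a s g : conj_sum a (s ^ g)%g = conj_sum a s.
Proof.
rewrite !conj_sumE [RHS](reindex_inj (mulgI g)) /=.
by apply: eq_bigr => h _; rewrite conjgM.
Qed.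

Lemma symalg_mulCA (k : C) a b : a * (k%:A * b) = k%:A * (a * b).
Proof. by rewrite !mulr_algl scalerAr. Qed.

Lemma conj_sum_comm a b : conj_sum a * b = b * conj_sum a.
Proof.
have comm s : conj_sum a * symelt C s = symelt C s * conj_sum a.
  have conjE : conj_sum a = symelt C s * conj_sum a * symelt C s^-1%g.
    by apply/ffunP=> r; rewrite symelt_conjE conj_sumJ.
  by rewrite [in LHS]conjE -mulrA -symeltM mulVg symelt1 mulr1.
rewrite [b]symalg_sum mulr_sumr mulr_suml; apply: eq_bigr => s _.
by rewrite symalg_mulCA comm mulrA.
Qed.

(** Some group element [s] already gives a nonzero product. A transposition inside one column of [u]
    and one row of the translated [t] would be absorbed by [rowsum] and change the sign of [colsum];
    so no such pair exists and [below_le] applies. *)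
Lemma rowsum_mul_colsum p t u a : is_tableau p u -> rowsum C t * a * colsum C u != 0 ->
  forall j, (below (tabloid t) j <= below (tabloid u) j)%N.
Proof.
move=> u_tab rac j.
have [s rsc|no_s] := pickP (fun s => rowsum C t * symelt C s * colsum C u != 0); last first.
  have expand (x y : A) : x * a * y = \sum_s (a s)%:A * (x * symelt C s * y).
    rewrite [a in LHS]symalg_sum mulr_sumr mulr_suml; apply: eq_bigr => s _.
    by rewrite symalg_mulCA -[LHS]mulrA.
  case/eqP: rac; rewrite expand big1 // => s _.
  by have /negbFE/eqP -> := no_s s; rewrite mulr0.
rewrite -(below_act s^-1%g); apply: (below_le _ u_tab) => x y; rewrite !ffunE => -[txy uxy].
apply: contra_neq_eq rsc => xy.
have rsN : rowsum C t * symelt C s * colsum C u = - (rowsum C t * symelt C s * colsum C u).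
  have row_s : row_stabiliser t (tperm (s^-1%g x) (s^-1%g y)).
    by apply/forallP=> z; case: tpermP => [->|->|//]; rewrite txy.
  (* Moving across [s] turns the row transposition of [t] into the column transposition of [u]. *)
  have tpermE : (tperm (s^-1 x) (s^-1 y) * s = s * tperm x y)%g.
    by rewrite -tpermJ conjgE invgK -!mulgA mulVg mulg1.
  rewrite -{1}(rowsum_symelt C row_s) -(mulrA _ _ (symelt C s)) -symeltM tpermE.
  rewrite symeltM mulrA -(mulrA _ (symelt C (tperm x y))) symelt_colsum.
    by rewrite odd_tperm xy mulN1r mulrN.
  by apply/forallP=> z; case: tpermP => [->|->|//]; rewrite uxy.
apply/ffunP=> r; have /ffunP/(_ r) := rsN; rewrite !ffunE => /eqP.
by rewrite -addr_eq0 -mulr2n mulrn_eq0 => /eqP.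
Qed.

Definition young_central t : A :=
  conj_sum (colsum C t * rowsum C t * star (colsum C t * rowsum C t)).

(** Every summand of the product contains a factor [rowsum C t * a * colsum C u]. By centrality the
    order may be exchanged, so it suffices that these factors vanish in one of the two orders; if
    they did in neither, each shape would dominate the other. *)
Lemma young_central_mul p q t u : is_tableau p t -> is_tableau q u -> p <> q ->
  young_central t * young_central u = 0.
Proof.
have mul0 t1 t2 : (forall a, rowsum C t1 * a * colsum C t2 = 0) ->
    young_central t1 * young_central t2 = 0.
  move=> rc0; rewrite /young_central /conj_sum mulr_suml big1 // => g _.
  rewrite mulr_sumr big1 // => h _; rewrite !starM !star_rowsum !star_colsum.
  transitivity (symelt C g * colsum C t1 * rowsum C t1 *
      (rowsum C t1 * (colsum C t1 * symelt C g^-1%g * symelt C h) * colsum C t2) *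
      (rowsum C t2 * rowsum C t2 * colsum C t2 * symelt C h^-1%g)).
    by rewrite !mulrA.
  by rewrite rc0 mulr0 mul0r.
move=> t_tab u_tab pq.
have [tu0|/existsNP[a /eqP tu]] :=
  pselect (forall a, rowsum C t * a * colsum C u = 0); first exact: mul0.
have [ut0|/existsNP[b /eqP ut]] := pselect (forall a, rowsum C u * a * colsum C t = 0).
  by rewrite conj_sum_comm; exact: mul0.
case: pq; apply: (below_tableau_inj t_tab u_tab) => j; apply/eqP; rewrite eqn_leq.
by rewrite (rowsum_mul_colsum u_tab tu) (rowsum_mul_colsum t_tab ut).
Qed.

Lemma rowsum_tabloid t : exists2 m : nat, (0 < m)%N &
  rowsum C t *: wordmod_elt C (tabloid t) = m%:R *: wordmod_elt C (tabloid t).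
Proof.
exists #|row_stabiliser t|.
  by apply/card_gt0P; exists 1%g; apply/forallP=> x; rewrite perm1.
rewrite /rowsum scaler_suml -sum1_card natr_sum scaler_suml.
apply: eq_bigr => s /forallP s_row; rewrite wordmod_symelt_act scale1r; congr wordmod_elt.
by apply/ffunP=> x; rewrite !ffunE; apply/eqP.
Qed.

(** The coefficient at the identity is the group order times the squared norm of
    [colsum C t * rowsum C t]. That element is nonzero, as it sends the tabloid of [t] to a positive
    multiple of the polytabloid. *)
Lemma young_central_neq0 p t : is_tableau p t -> young_central t != 0.
Proof.
move=> t_tab; apply/eqP=> /ffunP/(_ 1%g); rewrite conj_sumE ffunE.
under eq_bigr => g _ do rewrite conj1g.
move/eqP; rewrite sumr_const mulrn_eq0 mul_star1_eq0 => /orP[|/eqP cr0].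
  by rewrite -leqn0 leqNgt => /negP; apply; apply/card_gt0P; exists 1%g.
have [m m0 rt] := rowsum_tabloid t.
have : (colsum C t * rowsum C t) *: wordmod_elt C (tabloid t) = 0 by rewrite cr0 scale0r.
rewrite -scalerA rt !scaler_nat -scalerMnr -polytabloidE => /ffunP/(_ (tabloid t)).
rewrite ffunMnE polytabloid_tabloid ?ffunE; last exact: tableau_inj t_tab.
by move/eqP; rewrite pnatr_eq0 eqn0Ngt m0.
Qed.

Lemma star_conj_sum a : star (conj_sum a) = conj_sum (star a).
Proof.
rewrite /conj_sum (big_morph star starD star0); apply: eq_bigr => g _.
by rewrite !starM !star_symelt invgK mulrA.
Qed.

Lemma starK a : star (star a) = a.
Proof. by apply/ffunP=> s; rewrite !ffunE invgK conjCK. Qed.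

Lemma young_central_sq p t : is_tableau p t -> young_central t * young_central t != 0.
Proof.
move=> t_tab; have zz : star (young_central t) = young_central t.
  by rewrite /young_central star_conj_sum starM starK.
rewrite -{2}zz; apply/eqP=> zz0.
have := young_central_neq0 t_tab; rewrite -mul_star1_eq0 zz0 ffunE.
by rewrite eqxx.
Qed.

Definition shape_tableau p := xchoose (tableau_exists p).

Lemma shape_tableauP p : is_tableau p (shape_tableau p).
Proof. exact: xchooseP. Qed.

(* The elements young_central indexed by the cycle types that occur are
   linearly independent, and as many as the conjugacy classes, so they span the
   class functions. *)
Lemma one_young_central : exists (m : nat) (L : 'I_m -> intpart n) (c : 'I_m -> C),
  1 = \sum_i (c i)%:A * young_central (shape_tableau (L i)).
Proof.
pose L := undup [seq cycle_type s | s <- enum 'S_n].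
have memL s : cycle_type s \in L by rewrite mem_undup map_f ?mem_enum.
have /fin_all_exists[r rP] : forall i : 'I_(size L),
    exists s, cycle_type s = nth (cycle_type 1%g) L i.
  move=> i; have : nth (cycle_type 1%g) L i \in L by rewrite mem_nth.
  by rewrite mem_undup => /mapP[s _ ->]; exists s.
pose z (i : 'I_(size L)) := young_central (shape_tableau (nth (cycle_type 1%g) L i)).
have class_fun (a b : A) :
    (forall s g, a (s ^ g)%g = a s) -> (forall s g, b (s ^ g)%g = b s) ->
    (forall i, a (r i) = b (r i)) -> a = b.
  move=> aJ bJ ab; apply/ffunP=> s; have sL := memL s.
  have lt_i : (index (cycle_type s) L < size L)%N by rewrite index_mem.
  have [g ->] : exists g, s = (r (Ordinal lt_i) ^ g)%g.
    by apply: cycle_type_conj; rewrite rP /= nth_index.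
  by rewrite aJ bJ.
pose M : 'M[C]_(size L) := \matrix_(i, j) z i (r j).
have comb_classfun (c : 'I_(size L) -> C) s g :
    (\sum_i (c i)%:A * z i) (s ^ g)%g = (\sum_i (c i)%:A * z i) s.
  by rewrite !sum_ffunE; apply: eq_bigr => i _; rewrite mulr_algl !symalg_scaleE conj_sumJ.
have comb_mx (v : 'rV_(size L)) j : (\sum_i (v 0 i)%:A * z i) (r j) = (v *m M) 0 j.
  rewrite sum_ffunE mxE; apply: eq_bigr => i _.
  by rewrite mulr_algl symalg_scaleE mxE.
(* A row vector in the kernel gives a vanishing combination of the [z i]; multiplying by [z k]
   leaves only the [k]-th coefficient times the nonzero square of [z k]. *)
have M_unit : M \in unitmx.
  rewrite -row_free_unit -kermx_eq0; apply/rowV0P=> v /sub_kermxP vM.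
  have v0 : \sum_i (v 0 i)%:A * z i = 0.
    apply: class_fun => // [s g|i]; first by rewrite !ffunE.
    by rewrite comb_mx vM !ffunE mxE.
  apply/rowP=> k; rewrite mxE; apply/eqP.
  have : (\sum_i (v 0 i)%:A * z i) * z k = 0 by rewrite v0 mul0r.
  rewrite mulr_suml (bigD1 k) //= big1 ?addr0 => [|i ik].
    rewrite -mulrA mulr_algl => /eqP; rewrite scaler_eq0.
    by rewrite (negbTE (young_central_sq (shape_tableauP _))) orbF.
  rewrite -mulrA (young_central_mul (shape_tableauP _) (shape_tableauP _)) ?mulr0 //.
  by move/eqP; rewrite nth_uniq ?undup_uniq // => /eqP/val_inj/eqP; rewrite (negbTE ik).
exists (size L), (fun i => nth (cycle_type 1%g) L i).
(* The coefficients solve the linear system that prescribes the values of 1 at the representatives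
   [r j]. *)
exists (fun i => ((\row_j (1 : A) (r j)) *m invmx M) 0 i).
apply: class_fun => // [s g|i]; last by rewrite comb_mx mulmxKV // mxE.
by rewrite !ffunE conjg_eq1.
Qed.

End Center.

Section Generators.
Variables (F : fieldType) (n : nat).
Local Notation A := (symalg F n).

Lemma symalg_linear (V W : lmodType A) (f : V -> W) :
    {morph f : u v / u + v} -> (forall (k : F) v, f (k%:A *: v) = k%:A *: f v) ->
    (forall s v, f (symelt F s *: v) = symelt F s *: f v) ->
  linear f.
Proof.
move=> fD fk fs a u v; rewrite fD; congr (_ + _).
have f0 : f 0 = 0 by apply: (addrI (f 0)); rewrite -fD !addr0.
rewrite [a]symalg_sum !scaler_suml (big_morph f fD f0); apply: eq_bigr => s _.
by rewrite -!scalerA fk fs.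
Qed.

End Generators.

Section Completeness.
Variables (C : numClosedFieldType) (n : nat).
Local Notation A := (symalg C n).

(** This is the homomorphism induced by sending the tabloid of [t] to [rowsum C t *: w]. Summing
    over all permutations, not over cosets of the row stabiliser, is what produces the row sum;
    words outside the orbit of the tabloid go to 0. *)
Definition word_hom (V : lmodType A) (t : tableau n) (w : V) (f : wordmod C n) : V :=
  \sum_s (f (word_act s (tabloid t)))%:A *: (symelt C s *: w).

Lemma word_hom_linear (V : lmodType A) t (w : V) : linear (word_hom t w).
Proof.
apply: symalg_linear => [u v|k v|s v]; rewrite /word_hom.
- rewrite -big_split; apply: eq_bigr => s _.
  by rewrite ffunE scalerDl scalerDl.
- rewrite scaler_sumr; apply: eq_bigr => s _.
  by rewrite wordmod_algE [RHS]scalerA mulr_algl; congr (_ *: _); rewrite scalerA.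
- rewrite scaler_sumr (reindex_inj (mulgI s)); apply: eq_bigr => r _.
  by rewrite wordmod_symeltE -word_actM mulKg symeltM -scalerA alg_scalerCA.
Qed.

Lemma word_hom_tabloid (V : lmodType A) t (w : V) :
  word_hom t w (wordmod_elt C (tabloid t)) = rowsum C t *: w.
Proof.
rewrite /word_hom /rowsum scaler_suml [RHS]big_mkcond; apply: eq_bigr => s _.
have -> : row_stabiliser t s = (word_act s (tabloid t) == tabloid t).
  apply/forallP/eqP => [s_row|/ffunP s_tab x].
    by apply/ffunP=> x; rewrite !ffunE; apply/eqP.
  by apply/eqP; have := s_tab x; rewrite !ffunE.
by rewrite ffunE; case: eqP => _; rewrite ?scale1r ?scale1r // !scale0r.
Qed.

Lemma specht_hom_exists (V : lmodType A) (v : V) : v <> 0 ->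
  exists p (g : specht C p -> V), linear g /\ exists x, g x <> 0.
Proof.
move=> v0; have [m [L [c one]]] := one_young_central C n.
have [i /eqP zv] : exists i, young_central C (shape_tableau (L i)) *: v <> 0.
  apply/not_existsP=> zv; apply: v0; rewrite -[v]scale1r one scaler_suml big1 // => i _.
  by have /contrapT := zv i; rewrite -scalerA => ->; rewrite scaler0.
set t := shape_tableau (L i) in zv; have t_tab : is_tableau (L i) t := shape_tableauP _.
(* Since [star] exchanges the two factors of [colsum C t * rowsum C t], some conjugate summand of
   the central element does not kill [v]. The vector [w] below is what its right half makes of
   [v]. *)
have [g gv] : exists g : 'S_n, (colsum C t * rowsum C t) *:
    ((rowsum C t * colsum C t) *: (symelt C g^-1%g *: v)) <> 0.
  apply/not_existsP=> gv; case/eqP: zv; rewrite /young_central /conj_sum scaler_suml.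
  apply: big1 => g _; rewrite starM star_rowsum star_colsum -!scalerA.
  by have /contrapT := gv g; rewrite -!scalerA => ->; rewrite scaler0.
move: gv; set w := _ *: (symelt _ _ *: v) => cw.
exists (L i), (fun x => word_hom t w (val x)); split.
  by move=> a x y; rewrite -word_hom_linear.
exists (specht_sub (polytabloid_specht C t_tab)).
rewrite specht_subK polytabloidE (linear_mapZ (@word_hom_linear V t w)).
by rewrite word_hom_tabloid scalerA.
Qed.

End Completeness.

(** * Supermodules and their grading involutions *)

Section Isotypical.
Variable B : pzRingType.
Implicit Types (M S T V W : lmodType B).

Lemma linear_bijP V W (f : V -> W) : linear f -> injective f -> (forall y, exists x, f x = y) ->
  exists g : W -> V, [/\ linear g, cancel f g & cancel g f].
Proof.
move=> f_lin f_inj f_surj; have [g gP] := choice f_surj.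
have fK : cancel f g by move=> x; apply: f_inj; rewrite gP.
exists g; split=> // a x y; apply: f_inj.
by rewrite f_lin !gP.
Qed.

Lemma nonzero_exists V : [set: V] <> [set 0] -> exists x : V, x <> 0.
Proof.
move=> V0; apply/not_existsP=> V_0; apply: V0; apply/seteqP; split=> // x _.
exact: contrapT (V_0 x).
Qed.

(** The composite of [g] and [p1] identifies [T] with [S1], so any map from [T] is killed by [p2].
    Conversely an element killed by [p2] lies in the range of [g], since [p1] and [p2] are jointly
    injective. Stated for two projections so that the factors can be exchanged. *)
Lemma isotypical_component_proj M S1 S2 T (p1 : M -> S1) (p2 : M -> S2) (g : T -> M) :
    linear p1 -> linear p2 -> (forall x, p1 x = 0 -> p2 x = 0 -> x = 0) ->
    simple_module S1 -> simple_module T ->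
    (forall h : S1 -> S2, linear h -> forall x, h x = 0) ->
    linear g -> (exists x, p1 (g x) <> 0) ->
  isotypical_component M T = [set x | p2 x = 0].
Proof.
move=> p1_lin p2_lin p_inj S1_simple T_simple no_hom g_lin pg_neq0.
have pg_lin := linear_comp g_lin p1_lin.
have pg_inj := simple_inj T_simple pg_lin pg_neq0.
have [k [k_lin pgK kK]] := linear_bijP pg_lin pg_inj (simple_surj S1_simple pg_lin pg_neq0).
have p2_0 (h : T -> M) x : linear h -> p2 (h x) = 0.
  move=> h_lin; rewrite -[x]pgK.
  exact: (no_hom _ (linear_comp k_lin (linear_comp h_lin p2_lin))).
apply/seteqP; split=> v /=.
- move=> vM; apply: (vM [set x | p2 x = 0]).
    exact: preimage_submodule p2_lin (@zero_submodule _ _).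
  by move=> h h_lin _ _ [x _ <-] /=; exact: p2_0.
- move=> v0 U U_sub /(_ g g_lin) gU; apply: gU; first by move=> x y /(congr1 p1)/pg_inj.
  exists (k (p1 v)) => //; apply/eqP; rewrite -subr_eq0; apply/eqP/p_inj.
    by rewrite (linear_mapD p1_lin) (linear_mapN p1_lin) [X in X - _]kK subrr.
  by rewrite (linear_mapD p2_lin) (linear_mapN p2_lin) p2_0 // v0 subr0.
Qed.

Lemma snd_linear S1 S2 : linear (snd : S1 * S2 -> S2). Proof. by []. Qed.

Lemma isotypical_components_prod S1 S2 :
    simple_module S1 -> simple_module S2 ->
    (forall h : S1 -> S2, linear h -> forall x, h x = 0) ->
    (forall h : S2 -> S1, linear h -> forall x, h x = 0) ->
  isotypical_components (S1 * S2)%type =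
    [set [set x | x.2 = 0]; [set x | x.1 = 0]].
Proof.
move=> S1_simple S2_simple no12 no21.
have fst_comp T (g : T -> (S1 * S2)%type) : simple_module T -> linear g ->
    (exists x, (g x).1 <> 0) -> isotypical_component (S1 * S2)%type T = [set x | x.2 = 0].
  move=> T_simple g_lin g_neq0.
  apply: (@isotypical_component_proj _ _ _ _ fst snd g) => //.
  by case=> a b /= -> ->.
have snd_comp T (g : T -> (S1 * S2)%type) : simple_module T -> linear g ->
    (exists x, (g x).2 <> 0) -> isotypical_component (S1 * S2)%type T = [set x | x.1 = 0].
  move=> T_simple g_lin g_neq0.
  apply: (@isotypical_component_proj _ _ _ _ snd fst g) => //.
  by case=> a b /= -> ->.
have in1_lin : linear (fun u : S1 => (u, 0) : S1 * S2).
  by move=> a u v; congr pair; rewrite /= ?scaler0 ?addr0.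
have in2_lin : linear (fun u : S2 => (0, u) : S1 * S2).
  by move=> a u v; congr pair; rewrite /= ?scaler0 ?addr0.
have [x1 x1_neq0] := nonzero_exists S1_simple.1.
have [x2 x2_neq0] := nonzero_exists S2_simple.1.
apply/seteqP; split=> U /=.
- move=> [T [T_simple -> comp_neq0]].
  (* Without an embedding of [T], the zero submodule would already satisfy the condition defining
     the component. *)
  have [g [g_lin g_inj]] : exists g : T -> (S1 * S2)%type, linear g /\ injective g.
    apply: contrapT => no_g; apply: comp_neq0; apply/seteqP; split=> [v /=|v ->].
      move=> vM; apply: (vM [set 0]); first exact: zero_submodule.
      by move=> g g_lin g_inj; case: no_g; exists g.
    by move=> V [V0 _].
  have [x x0] := nonzero_exists T_simple.1.
  have gx : g x <> 0 by rewrite -(linear_map0 g_lin) => /g_inj.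
  have [gx1|gx1] := pselect ((g x).1 = 0).
    right; apply: (snd_comp _ g) => //; exists x => gx2; apply: gx.
    by move: gx1 gx2; case: (g x) => a b /= -> ->.
  by left; apply: (fst_comp _ g) => //; exists x.
- case=> ->.
    exists S1; split=> //.
      by rewrite (fst_comp _ _ S1_simple in1_lin) //; exists x1.
    by move/seteqP=> [/(_ (x1, 0) erefl) [/x1_neq0]].
  exists S2; split=> //.
    by rewrite (snd_comp _ _ S2_simple in2_lin) //; exists x2.
  by move/seteqP=> [/(_ (0, x2) erefl) [/x2_neq0]].
Qed.

End Isotypical.

Section TwistedMaps.
Variables (F : fieldType) (n : nat).
Local Notation A := (symalg F n).
Implicit Types (U V W : lmodType A).

(** Such a map is a homomorphism to [W] tensored with the sign character. Associators and grading
    involutions are of this kind, and two of them compose to a homomorphism. *)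
Definition twisted V W (f : V -> W) : Prop :=
  field_linear f /\
  forall s v, f (symelt F s *: v) = (-1) ^+ s *: (symelt F s *: f v).

Lemma field_linearD V W (f : V -> W) : field_linear f -> {morph f : u v / u + v}.
Proof. by move=> f_lin u v; rewrite -[u in LHS]scale1r -[1](scale1r 1) f_lin !scale1r. Qed.

Lemma field_linear0 V W (f : V -> W) : field_linear f -> f 0 = 0.
Proof. by move=> f_lin; apply: (addrI (f 0)); rewrite -(field_linearD f_lin) !addr0. Qed.

Lemma field_linearZ V W (f : V -> W) : field_linear f ->
  forall (k : F) v, f (k%:A *: v) = k%:A *: f v.
Proof.
by move=> f_lin k v; rewrite -[LHS]/(f _) -[_ *: v]addr0 f_lin (field_linear0 f_lin) addr0.
Qed.

Lemma field_linearN V W (f : V -> W) : field_linear f -> {morph f : v / - v}.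
Proof.
move=> f_lin v; apply: (addrI (f v)).
by rewrite -(field_linearD f_lin) !subrr (field_linear0 f_lin).
Qed.

Lemma field_linear_comp U V W (f : U -> V) (g : V -> W) :
  field_linear f -> field_linear g -> field_linear (g \o f).
Proof. by move=> f_lin g_lin k u v; rewrite /= f_lin g_lin. Qed.

Lemma linear_field_linear V W (f : V -> W) : linear f -> field_linear f.
Proof. by move=> f_lin k u v; rewrite f_lin. Qed.

Lemma symalg_linearP V W (f : V -> W) : field_linear f ->
  (forall s v, f (symelt F s *: v) = symelt F s *: f v) -> linear f.
Proof.
move=> f_lin; apply: symalg_linear; first exact: field_linearD.
exact: field_linearZ.
Qed.

Lemma scale_signC V (b : bool) (a : A) (v : V) :
  a *: ((-1) ^+ b *: v) = (-1) ^+ b *: (a *: v).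
Proof. by case: b; rewrite ?scale1r // !scaleN1r scalerN. Qed.

Lemma linear_sign V W (f : V -> W) (b : bool) (v : V) : field_linear f ->
  f ((-1) ^+ b *: v) = (-1) ^+ b *: f v.
Proof. by move=> f_lin; case: b; rewrite ?scale1r // !scaleN1r (field_linearN f_lin). Qed.

Lemma scale_signK V (b : bool) (v : V) : (-1) ^+ b *: ((-1) ^+ b *: v) = v.
Proof. by case: b; rewrite ?scale1r // !scaleN1r opprK. Qed.

Lemma twisted_comp U V W (f : U -> V) (g : V -> W) :
  twisted f -> twisted g -> linear (g \o f).
Proof.
move=> [f_lin f_s] [g_lin g_s]; apply: symalg_linearP; first exact: field_linear_comp.
by move=> s v; rewrite /= f_s linear_sign // g_s scale_signK.
Qed.

Lemma twisted_linear_comp U V W (f : U -> V) (g : V -> W) :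
  twisted f -> linear g -> twisted (g \o f).
Proof.
move=> [f_lin f_s] g_lin; have g_fl := linear_field_linear g_lin.
split; first exact: field_linear_comp.
by move=> s v; rewrite /= f_s linear_sign // (linear_mapZ g_lin).
Qed.

Lemma linear_twisted_comp U V W (f : U -> V) (g : V -> W) :
  linear f -> twisted g -> twisted (g \o f).
Proof.
move=> f_lin [g_lin g_s]; have f_fl := linear_field_linear f_lin.
split; first exact: field_linear_comp.
by move=> s v; rewrite /= (linear_mapZ f_lin) g_s.
Qed.

Lemma twisted_inv V W (f : V -> W) (g : W -> V) :
  twisted f -> cancel f g -> cancel g f -> twisted g.
Proof.
move=> [f_lin f_s] fK gK; split=> [k u v|s v]; apply: (can_inj fK).
  by rewrite f_lin !gK.
by rewrite linear_sign // f_s !gK scale_signK.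
Qed.

Lemma twisted_part V W (f : V -> W) i (a : A) v : twisted f ->
  symalg_super F n i a -> f (a *: v) = (-1) ^+ i *: (a *: f v).
Proof.
move=> [f_lin f_s] a_i; rewrite [a]symalg_sum !scaler_suml scaler_sumr.
rewrite (big_morph f (field_linearD f_lin) (field_linear0 f_lin)).
apply: eq_bigr => s _; rewrite -!scalerA (field_linearZ f_lin) f_s.
have [<-|s_i] := eqVneq (odd_perm s) i; first by rewrite scale_signC.
by rewrite a_i // !scale0r scaler0.
Qed.

End TwistedMaps.

Section Involution.
Variables (C : numClosedFieldType) (n : nat).
Local Notation A := (symalg C n).

Lemma half_addrr (V : lmodType A) (v : V) : (2^-1 : C)%:A *: (v + v) = v.
Proof.
rewrite -mulr2n -scaler_nat scalerA mulr_algl -scaler_nat scalerA.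
by rewrite mulVf ?scale1r ?scale1r // pnatr_eq0.
Qed.

Section FromInvolution.
Variables (V : lmodType A) (tau : V -> V).
Hypotheses (tau_tw : twisted tau) (tauK : involutive tau).

Definition eigen_part (i : bool) : set V := [set v | tau v = (-1) ^+ i *: v].

Lemma eigen_part_subspace i : is_subspace (eigen_part i).
Proof.
have tau_lin := tau_tw.1; split.
  by rewrite /eigen_part /= (field_linear0 tau_lin) scaler0.
by move=> k u v /= tu tv; rewrite /eigen_part /= tau_lin tu tv scalerDr scale_signC.
Qed.

Lemma eigen_part_direct : direct_sum2 eigen_part.
Proof.
have tau_lin := tau_tw.1; move=> v.
exists ((2^-1 : C)%:A *: (v + tau v), (2^-1 : C)%:A *: (v - tau v)); split.
  split; rewrite /eigen_part /=.
  - by rewrite (field_linearZ tau_lin) (field_linearD tau_lin) tauK scale1r addrC.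
  - rewrite (field_linearZ tau_lin) (field_linearD tau_lin) (field_linearN tau_lin) tauK.
    by rewrite scaleN1r -scalerN opprB addrC.
  - by rewrite -scalerDr addrACA subrr addr0 half_addrr.
move=> [x y] [/= tx ty ->]; rewrite /eigen_part /= scale1r in tx.
rewrite /eigen_part /= scaleN1r in ty.
rewrite (field_linearD tau_lin) tx ty; congr pair.
  by rewrite addrACA subrr addr0 half_addrr.
by rewrite opprD opprK addrACA subrr add0r half_addrr.
Qed.

Lemma eigen_part_act i j a v : symalg_super C n i a -> eigen_part j v ->
  eigen_part (i (+) j) (a *: v).
Proof.
move=> a_i /= tv; rewrite /eigen_part /= (twisted_part _ tau_tw a_i) tv.
by rewrite scale_signC scalerA signr_addb.
Qed.

Definition involution_supermodule : supermodule (symalg_super C n) :=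
  Supermodule eigen_part_subspace eigen_part_direct eigen_part_act.

End FromInvolution.

Definition grading_involution (V : supermodule (symalg_super C n)) (tau : V -> V) : Prop :=
  [/\ twisted tau, involutive tau & forall i v, sm_part V i v <-> tau v = (-1) ^+ i *: v].

Arguments grading_involution : clear implicits.

Lemma symelt_part s : symalg_super C n (odd_perm s) (symelt C s).
Proof. by move=> r rs; rewrite ffunE; case: (r =P s) rs => [->|//]; rewrite eqxx. Qed.

Section GradingInvolution.
Variable V : supermodule (symalg_super C n).

Lemma supermodule_involution : exists tau, grading_involution V tau.
Proof.
have partD i u v : sm_part V i u -> sm_part V i v -> sm_part V i (u + v).
  move=> ui vi; have [_ /(_ 1 u v ui vi)] := sm_subspace V i.
  by rewrite scale1r scale1r.
have part0 i : sm_part V i 0 by have [] := sm_subspace V i.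
have partZ i (k : C) u : sm_part V i u -> sm_part V i (k%:A *: u).
  by move=> ui; have [_ /(_ k u 0 ui (part0 i))] := sm_subspace V i; rewrite addr0.
have part_elt i s v : sm_part V i v -> sm_part V (odd_perm s (+) i) (symelt C s *: v).
  by apply: sm_act; apply: symelt_part.
have [p pP] := choice (fun v => @sm_direct _ _ _ V v).
pose tau v := (p v).1 - (p v).2.
have tauE u v : sm_part V false u -> sm_part V true v -> tau (u + v) = u - v.
  move=> u0 v1; rewrite /tau; have [_ /(_ (u, v))] := pP (u + v).
  by move=> ->.
have split_v v : exists x y, [/\ sm_part V false x, sm_part V true y & v = x + y].
  by have [[p0 p1 vE] _] := pP v; exists (p v).1, (p v).2.
have tau0 v : sm_part V false v -> tau v = v.
  by move=> v0; have := tauE v 0 v0 (part0 _); rewrite addr0 subr0.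
have tau1 v : sm_part V true v -> tau v = - v.
  by move=> v1; have := tauE 0 v (part0 _) v1; rewrite add0r sub0r.
have tauD u v : tau (u + v) = tau u + tau v.
  have [x [y [x0 y1 ->]]] := split_v u; have [z [w [z0 w1 ->]]] := split_v v.
  by rewrite addrACA !tauE ?opprD 1?addrACA //; apply: partD.
exists tau; split.
- split=> [k u v|s u].
    rewrite tauD; congr (_ + _); have [x [y [x0 y1 ->]]] := split_v u.
    by rewrite scalerDr !tauE ?scalerBr //; apply: partZ.
  have [x [y [x0 y1 ->]]] := split_v u; rewrite tauE // scalerDr.
  move: (part_elt _ s _ x0) (part_elt _ s _ y1).
  case: (odd_perm s) => /= sx sy; last by rewrite tauE // scale1r scalerBr.
  by rewrite addrC tauE // scaleN1r scalerBr opprB.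
- move=> v; have [x [y [x0 y1 ->]]] := split_v v.
  rewrite tauE // tauE ?opprK //; have := partZ true (-1) y y1.
  by rewrite scaleN1r scaleN1r.
- move=> i v; split; first by case: i => [/tau1|/tau0] ->; rewrite ?scaleN1r ?scale1r.
  have [x [y [x0 y1 ->]]] := split_v v; rewrite tauE //; case: i.
    rewrite scaleN1r opprD => /addIr xx.
    suff -> : x = 0 by rewrite add0r.
    by rewrite -[x]half_addrr {1}xx addNr scaler0.
  rewrite scale1r => /addrI yy.
  suff -> : y = 0 by rewrite addr0.
  by rewrite -[y]half_addrr -{1}yy addNr scaler0.
Qed.

End GradingInvolution.

(** The homogeneous components of [v] are half of [v + tau v] and half of [v - tau v]. *)
Lemma graded_submodule_involution (V : supermodule (symalg_super C n)) (tau : V -> V)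
    (U : set V) : grading_involution V tau ->
  graded_submodule U <-> is_submodule U /\ forall v, U v -> U (tau v).
Proof.
move=> [tau_tw tauK part_tau]; have tau_lin := tau_tw.1; split.
- move=> [U_sub U_gr]; split=> // v Uv; have [U0 UD] := U_sub.
  have [[x y] [[/= x0 y1 vE] _]] := @sm_direct _ _ _ V v.
  have [Ux Uy] : U x /\ U y by apply: U_gr; rewrite -?vE.
  rewrite vE (field_linearD tau_lin) (proj1 (part_tau _ _) x0).
  rewrite (proj1 (part_tau _ _) y1) scale1r addrC.
  exact: UD.
- move=> [U_sub U_tau]; split=> // x y x0 y1 Uxy; have [U0 UD] := U_sub.
  have Uxy' : U (x - y).
    have := U_tau _ Uxy; rewrite (field_linearD tau_lin).
    by rewrite (proj1 (part_tau _ _) x0) (proj1 (part_tau _ _) y1) scale1r scaleN1r.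
  have Ux : U x.
    suff -> : x = (2^-1 : C)%:A *: (1 *: (x + y) + (x - y)) + 0.
      by apply: (UD) => //; apply: (UD).
    by rewrite scale1r addr0 addrACA subrr addr0 half_addrr.
  split=> //; suff -> : y = (-1) *: x + (x + y) by apply: UD.
  by rewrite scaleN1r addKr.
Qed.


(** An odd isomorphism is twisted, so following it by the grading involution of [W] makes it
    linear. *)
Lemma linear_of_homogeneous (V W : supermodule (symalg_super C n)) :
  homogeneously_isomorphic V W -> exists G : V -> W, linear G /\ injective G.
Proof.
move=> [b [f [[f_lin f_part f_act] /bij_inj f_inj]]].
have [tV _] := supermodule_involution V.
have [tW [tW_tw tWK _]] := supermodule_involution W.
have f_elt s v : f (symelt C s *: v) = (-1) ^+ (odd_perm s && b) *: (symelt C s *: f v).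
  by apply: f_act; apply: symelt_part.
case: b f_elt {f_part f_act} => f_elt.
  exists (tW \o f); split; last exact: inj_comp (inv_inj tWK) f_inj.
  apply: (twisted_comp _ tW_tw); split=> // s v.
  by rewrite f_elt andbT.
exists f; split=> //; apply: symalg_linearP => // s v.
by rewrite f_elt andbF scale1r.
Qed.

Section Intertwining.
Variables (V W : supermodule (symalg_super C n)) (tV : V -> V) (tW : W -> W).
Hypotheses (gV : grading_involution V tV) (gW : grading_involution W tW).

(** If [G] anticommutes with the involutions it exchanges parities but lacks the sign of an odd
    homomorphism; composing with [tW] supplies that sign. *)
Lemma homogeneous_of_linear (eps : bool) (G : V -> W) : linear G -> bijective G ->
  (forall v, G (tV v) = (-1) ^+ eps *: tW (G v)) -> homogeneously_isomorphic V W.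
Proof.
move: gV gW => [tV_tw tVK tVP] [tW_tw tWK tWP] G_lin G_bij Gt.
have G_fl := linear_field_linear G_lin; case: eps Gt => Gt.
  have f_tw := linear_twisted_comp G_lin tW_tw.
  exists true, (tW \o G); split; last exact: bij_comp (inv_bij tWK) G_bij.
  split=> [|i v /tVP v_i|i a v a_i]; first by have [] := f_tw.
    have Gv : (-1) ^+ i *: G v = (-1) ^+ true *: tW (G v).
      by rewrite -(linear_sign _ _ G_fl) -v_i Gt.
    by apply/tWP; rewrite /= tWK -[LHS](scale_signK i) Gv scalerA -signr_addb.
  by rewrite andbT (twisted_part _ f_tw a_i).
exists false, G; split=> //; split=> // [i v /tVP v_i|i a v a_i].
  by apply/tWP; rewrite addbF -(linear_sign _ _ G_fl) -v_i Gt scale1r.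
by rewrite andbF scale1r (linear_mapZ G_lin).
Qed.

End Intertwining.

(** Schur's lemma for supermodules: commuting with the involutions up to sign makes the kernel and
    the range of [G] graded. The isomorphism obtained is the inverse of [G]. *)
Lemma schur_super (V W : supermodule (symalg_super C n)) (tV : V -> V) (tW : W -> W)
    (eps : bool) (G : V -> W) :
    grading_involution V tV -> grading_involution W tW ->
    simple_supermodule V -> simple_supermodule W ->
    linear G -> (forall v, G (tV v) = (-1) ^+ eps *: tW (G v)) ->
    (exists x, G x <> 0) ->
  homogeneously_isomorphic W V.
Proof.
move=> gV gW [_ V_simple] [_ W_simple] G_lin Gt [x Gx].
have [[tV_lin _] tVK _] := gV; have [[tW_lin _] tWK _] := gW.
have G_inj : injective G.
  have [|K0|KT] := V_simple (G @^-1` [set 0]).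
  - apply/(graded_submodule_involution _ gV); split.
      exact: preimage_submodule G_lin (@zero_submodule _ _).
    by move=> v /= Gv; rewrite Gt Gv (field_linear0 tW_lin) scaler0.
  - apply: (linear_inj G_lin) => y Gy; have : (G @^-1` [set 0]) y by [].
    by rewrite K0.
  - by have : (G @^-1` [set 0]) x by rewrite KT.
have G_surj y : exists z, G z = y.
  have [|R0|RT] := W_simple (range G).
  - apply/(graded_submodule_involution _ gW); split; first exact: range_submodule.
    move=> _ [v _ <-]; exists ((-1) ^+ eps *: tV v) => //.
    by rewrite (linear_mapZ G_lin) Gt scale_signK.
  - have : range G (G x) by exists x.
    by rewrite R0 => /Gx.
  - have : range G y by rewrite RT.
    by case=> z _ <-; exists z.
have [H [H_lin GK HK]] := linear_bijP G_lin G_inj G_surj.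
apply: (homogeneous_of_linear gW gV (eps := eps) H_lin); first by exists G.
by move=> w; apply: G_inj; rewrite HK (linear_mapZ G_lin) Gt HK scale_signK.
Qed.

End Involution.
Arguments grading_involution {C n}.

Section InvolutionSupermodule.
Variables (C : numClosedFieldType) (n : nat).
Local Notation A := (symalg C n).

Lemma involution_supermoduleP (V : lmodType A) (tau : V -> V) (tau_tw : twisted tau)
    (tauK : involutive tau) :
  grading_involution (involution_supermodule tau_tw tauK) tau.
Proof. by split. Qed.

Lemma simple_supermodule_of_simple (V : supermodule (symalg_super C n)) :
  simple_module V -> simple_supermodule V.
Proof. by move=> [V0 V_simple]; split=> // U [U_sub _]; exact: V_simple. Qed.

Lemma involution_supermodule_iso (S : lmodType A) (tau : S -> S) (tau_tw : twisted tau)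
    (tauK : involutive tau) (V : supermodule (symalg_super C n)) (g : S -> V) :
    simple_module S -> simple_supermodule V -> linear g -> (exists x, g x <> 0) ->
  homogeneously_isomorphic V (involution_supermodule tau_tw tauK).
Proof.
move=> S_simple V_simple g_lin [x gx].
have [tV gV] := supermodule_involution V; have [tV_tw tVK _] := gV; have tV_lin := tV_tw.1.
have gS := involution_supermoduleP tau_tw tauK.
have W_simple : simple_supermodule (involution_supermodule tau_tw tauK).
  exact: simple_supermodule_of_simple.
have k_lin : linear (tV \o (g \o tau)).
  exact: twisted_comp (twisted_linear_comp tau_tw g_lin) tV_tw.
pose G (b : bool) (v : S) := g v + (-1) ^+ b *: tV (g (tau v)).
have G_lin b : linear (G b).
  move=> a u v; have /= kl := k_lin a u v.
  by rewrite /G g_lin kl [in LHS]scalerDr -scale_signC [in RHS]scalerDr addrACA.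
have Gt b v : G b (tau v) = (-1) ^+ b *: tV (G b v).
  rewrite /G tauK (field_linearD tV_lin) (linear_sign _ _ tV_lin) tVK scalerDr scale_signK.
  exact: addrC.
have [G0|G0] := pselect (exists v, G false v <> 0).
  exact: (schur_super gS gV W_simple V_simple (G_lin false) (Gt false)).
(* If both [G false] and [G true] vanished at [x], so would their sum, which is twice [g x]. *)
apply: (schur_super gS gV W_simple V_simple (G_lin true) (Gt true)).
exists x => G1; apply: gx; rewrite -[LHS]half_addrr.
have /contrapT : ~ G false x <> 0 by move=> Gx; apply: G0; exists x.
rewrite /G scale1r => G2; move: G1; rewrite /G scaleN1r => /eqP; rewrite subr_eq0.
by move=> /eqP {1}->; rewrite addrC G2 scaler0.
Qed.

Section Doubling.
Variables (S1 S2 : lmodType A) (f : S1 -> S2) (g : S2 -> S1).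
Hypotheses (f_tw : twisted f) (fK : cancel f g) (gK : cancel g f).

(** In a supermodule [S1] and [S2] occur together: the twists of [g] and of the grading involution
    cancel. This allows passing from a partition to its conjugate. *)
Lemma transfer_hom (V : supermodule (symalg_super C n)) (k : S1 -> V) :
    linear k -> (exists x, k x <> 0) ->
  exists h : S2 -> V, linear h /\ exists x, h x <> 0.
Proof.
move=> k_lin [x kx]; have [tV [tV_tw tVK _]] := supermodule_involution V.
exists (tV \o (k \o g)); split.
  have g_tw := twisted_inv f_tw fK gK.
  exact: twisted_comp (twisted_linear_comp g_tw k_lin) tV_tw.
exists (f x); rewrite /comp fK => tkx; apply: kx; apply: (inv_inj tVK).
by rewrite tkx (field_linear0 tV_tw.1).
Qed.

Definition swap_by (x : S1 * S2) : S1 * S2 := (g x.2, f x.1).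

Lemma swap_byK : involutive swap_by.
Proof. by case=> u w; rewrite /swap_by /= fK gK. Qed.

Lemma swap_by_twisted : twisted swap_by.
Proof.
have [f_lin f_s] := f_tw; have [g_lin g_s] := twisted_inv f_tw fK gK.
split=> [k [u w] [u' w']|s [u w]].
  by rewrite /swap_by /= f_lin g_lin.
by rewrite /swap_by /= f_s g_s.
Qed.

Definition double_supermodule : supermodule (symalg_super C n) :=
  involution_supermodule swap_by_twisted swap_byK.

Lemma double_supermodule_even :
  sm_part double_supermodule false = [set x | exists u, x = (u, f u)].
Proof.
apply/seteqP; split=> [[u w]|_ [u ->]]; rewrite /sm_part /= /eigen_part /= /swap_by /=.
  by rewrite scale1r => -[_ <-]; exists u.
by rewrite fK scale1r.
Qed.

Lemma double_supermodule_odd :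
  sm_part double_supermodule true = [set x | exists u, x = (u, - f u)].
Proof.
have f_lin := f_tw.1.
apply/seteqP; split=> [[u w]|_ [u ->]]; rewrite /sm_part /= /eigen_part /= /swap_by /=.
  by rewrite scaleN1r => -[_ e]; exists u; congr pair; rewrite e opprK.
rewrite scaleN1r -(field_linearN f_lin) fK.
by congr pair; rewrite /= (field_linearN f_lin) opprK.
Qed.

Hypotheses (S1_simple : simple_module S1) (S2_simple : simple_module S2).

(** A Goursat argument on the intersection of [U] with the first factor and its projection to that
    factor. In the mixed case [U] is the graph of a homomorphism between the factors, which must be
    zero. *)
Lemma double_supermodule_simple : (forall h : S1 -> S2, linear h -> forall x, h x = 0) ->
  simple_supermodule double_supermodule.
Proof.
move=> no_hom; have gt := involution_supermoduleP swap_by_twisted swap_byK.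
have g_lin := (twisted_inv f_tw fK gK).1; have f_lin := f_tw.1.
have [S1_neq0 S1_sub] := S1_simple; split.
  move=> T0; apply: S1_neq0; apply/seteqP; split=> // u _.
  have : [set 0] ((u, 0) : double_supermodule) by rewrite -T0.
  by case.
move=> U /(graded_submodule_involution _ gt)[[U0 UD] U_swap].
have UDD x y : U x -> U y -> U (x + y) by move=> Ux Uy; rewrite -[x]scale1r; apply: UD.
have K_sub : is_submodule [set u | U (u, 0)].
  split=> // a u v /= Uu Uv.
  suff -> : (a *: u + v, 0) = a *: (u, 0) + (v, 0) :> S1 * S2 by apply: UD.
  by congr pair; rewrite /= scaler0 addr0.
have [K0|KT] := S1_sub _ K_sub; last first.
  right; apply/seteqP; split=> // -[u w] _.
  have U1 v : U (v, 0) by have : [set u | U (u, 0)] v by rewrite KT.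
  have -> : (u, w) = (u, 0) + (0, w) :> S1 * S2 by congr pair; rewrite /= ?addr0 ?add0r.
  apply: UDD => //; have := U_swap _ (U1 (g w)).
  by rewrite /swap_by /= (field_linear0 g_lin) gK.
(* The swap carries the intersection with the second factor to the one with the first, so both are
   zero. *)
have K2 w : U (0, w) -> w = 0.
  move=> /U_swap; rewrite /swap_by /= (field_linear0 f_lin) => Uw.
  have : [set u | U (u, 0)] (g w) by [].
  by rewrite K0 /= => /(congr1 f); rewrite gK (field_linear0 f_lin).
have R_sub : is_submodule [set u | exists w, U (u, w)].
  split; first by exists 0.
  by move=> a u v [w Uw] [z Uz]; exists (a *: w + z); exact: (UD a _ _ Uw Uz).
have [R0|RT] := S1_sub _ R_sub.
  left; apply/seteqP; split=> [[u w] Uuw|_ ->] //.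
  have u0 : u = 0 by have : [set u | exists w, U (u, w)] u by [exists w]; rewrite R0.
  by rewrite u0 in Uuw *; rewrite (K2 _ Uuw).
have /choice[h hP] : forall u, exists w, U (u, w).
  by move=> u; have : [set u | exists w, U (u, w)] u by rewrite RT.
have h_lin : linear h.
  move=> a u v; apply/eqP; rewrite -subr_eq0; apply/eqP/K2.
  suff -> : (0, h (a *: u + v) - (a *: h u + h v)) =
      (-1) *: (a *: (u, h u) + (v, h v)) + (a *: u + v, h (a *: u + v)) :> S1 * S2.
    by apply: (UD) => //; apply: (UD).
  by congr pair; rewrite /= scaleN1r ?addNr // addrC.
(* The graph of the zero map is the first factor, whose intersection with [U] was assumed to be
   zero. *)
case: S1_neq0; apply/seteqP; split=> // u _ /=.
have : [set u | U (u, 0)] u by rewrite /= -(no_hom h h_lin u).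
by rewrite K0.
Qed.

Lemma double_supermodule_reducible : reducible_module double_supermodule.
Proof.
have [u u0] := nonzero_exists S1_simple.1.
have [w w0] := nonzero_exists S2_simple.1.
exists [set x : S1 * S2 | x.2 = 0]; split.
- exact: (preimage_submodule (@snd_linear _ S1 S2) (@zero_submodule _ S2)).
- by move/seteqP=> [/(_ (u, 0) erefl) [/u0]].
- by move/seteqP=> [_ /(_ (0, w) I) /= /w0].
Qed.

Lemma double_supermodule_iso (V : supermodule (symalg_super C n)) (k : S1 -> V) :
    simple_supermodule double_supermodule -> simple_supermodule V -> linear k ->
    (exists x, k x <> 0) ->
  homogeneously_isomorphic V double_supermodule.
Proof.
move=> W_simple V_simple k_lin [x kx].
have [tV gV] := supermodule_involution V; have [tV_tw tVK _] := gV; have tV_lin := tV_tw.1.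
have gW := involution_supermoduleP swap_by_twisted swap_byK.
have g_tw := twisted_inv f_tw fK gK.
have l_lin : linear (tV \o (k \o g)).
  exact: twisted_comp (twisted_linear_comp g_tw k_lin) tV_tw.
pose G (y : S1 * S2) := k y.1 + tV (k (g y.2)).
apply: (@schur_super _ _ double_supermodule V swap_by tV false G) => //.
- move=> a [u w] [u' w']; have /= ll := l_lin a w w'.
  by rewrite /G /= k_lin ll scalerDr addrACA.
- case=> u w; rewrite /G /swap_by /= fK scale1r (field_linearD tV_lin) tVK.
  exact: addrC.
- exists (x, 0); rewrite /G /= (field_linear0 g_tw.1) (linear_map0 k_lin).
  by rewrite (field_linear0 tV_lin) addr0.
Qed.

End Doubling.
End InvolutionSupermodule.

(** * Simple supermodules attached to partitions *)

Section SpechtSupermodules.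
Variables (C : numClosedFieldType) (n : nat).
Local Notation A := (symalg C n).
Implicit Types p q : intpart n.
Variable phi : forall p : intpart n, specht C p -> specht C (conj_part p).
Hypothesis phi_assoc : associator_family phi.
Arguments phi : clear implicits.

Lemma associator_twisted p : twisted (phi p).
Proof. by have [phi_lin _ phi_s _] := phi_assoc; split; [exact: phi_lin | exact: phi_s]. Qed.

Lemma associator_inv_ex p : exists g, cancel (phi p) g /\ cancel g (phi p).
Proof. by have [_ /(_ p)[g fK gK] _ _] := phi_assoc; exists g. Qed.

(** The inverse is chosen, because [phi (conj_part p)] takes values in the type for
    [conj_part (conj_part p)], not in [specht C p]. *)
Definition associator_inv p := sval (cid (associator_inv_ex p)).
Arguments associator_inv : clear implicits.

Lemma associatorK p : cancel (phi p) (associator_inv p).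
Proof. by rewrite /associator_inv; case: cid => g []. Qed.

Lemma associator_invK p : cancel (associator_inv p) (phi p).
Proof. by rewrite /associator_inv; case: cid => g []. Qed.

Definition specht_double p : supermodule (symalg_super C n) :=
  double_supermodule (associator_twisted p) (@associatorK p) (@associator_invK p).

Lemma specht_no_hom p q : p <> q -> forall h : specht C p -> specht C q, linear h ->
  forall x, h x = 0.
Proof.
move=> pq h h_lin x; apply: contrapT => hx; apply: pq.
by apply: (specht_hom_eq h_lin); exists x.
Qed.

Section SelfConjugate.
Variables (p : intpart n) (p_conj : p = conj_part p).

Fact specht_set_conj (x : specht C p) : specht_set p (val (phi p x)).
Proof. by rewrite {1}p_conj; exact: specht_valP. Qed.

(** The associator is made an endomorphism by keeping its value in the common word module, which
    avoids a cast along [p_conj]. *)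
Definition specht_flip (x : specht C p) : specht C p := specht_sub (specht_set_conj x).

Lemma specht_flip_val x : val (specht_flip x) = val (phi p x).
Proof. by []. Qed.

Lemma specht_flipK : involutive specht_flip.
Proof.
have [_ _ _ phiK] := phi_assoc.
(* The two indices are variables here so that their equality can be substituted; it is then used for
   [p] and [conj_part p]. *)
have phi_eq q r (x : specht C q) (y : specht C r) : q = r -> val x = val y ->
    val (phi q x) = val (phi r y).
  by move=> qr; move: y; rewrite -qr => y /val_inj ->.
move=> x; apply: val_inj; rewrite specht_flip_val -[RHS]phiK.
exact: phi_eq.
Qed.

Lemma specht_flip_twisted : twisted specht_flip.
Proof.
have [phi_lin phi_s] := associator_twisted p.
split=> [k u v|s v]; apply: val_inj.
  by rewrite specht_flip_val phi_lin.
rewrite specht_flip_val phi_s; by case: (odd_perm s).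
Qed.

Definition specht_super : supermodule (symalg_super C n) :=
  involution_supermodule specht_flip_twisted specht_flipK.

End SelfConjugate.

Definition specht_supermodule p : supermodule (symalg_super C n) :=
  match pselect (p = conj_part p) with
  | left p_conj => specht_super p_conj
  | right _ => specht_double p
  end.

Lemma specht_supermodule_simple p : simple_supermodule (specht_supermodule p).
Proof.
rewrite /specht_supermodule; case: pselect => [p_conj|p_conj].
  exact/simple_supermodule_of_simple/specht_simple.
apply: double_supermodule_simple; try exact: specht_simple.
exact: specht_no_hom.
Qed.

Lemma specht_supermodule_complete (V : supermodule (symalg_super C n)) p
    (g : specht C p -> V) : simple_supermodule V -> linear g -> (exists x, g x <> 0) ->
  homogeneously_isomorphic V (specht_supermodule p).
Proof.
move=> V_simple g_lin g_neq0; have := specht_supermodule_simple p.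
rewrite /specht_supermodule; case: pselect => [p_conj|p_conj] W_simple.
  apply: (involution_supermodule_iso _ _ _ V_simple g_lin g_neq0).
  exact: specht_simple.
exact: (double_supermodule_iso W_simple V_simple g_lin g_neq0).
Qed.

Lemma specht_hom_conj (V : supermodule (symalg_super C n)) p (g : specht C p -> V) :
    linear g -> (exists x, g x <> 0) ->
  exists h : specht C (conj_part p) -> V, linear h /\ exists x, h x <> 0.
Proof.
exact: transfer_hom (associator_twisted p) (@associatorK p) (@associator_invK p) V g.
Qed.

Lemma specht_supermodule_sub p : exists2 i : specht C p -> specht_supermodule p,
  linear i & injective i.
Proof.
rewrite /specht_supermodule; case: pselect => [p_conj|p_conj].
  by exists id.
exists (fun u => (u, 0) : specht C p * specht C (conj_part p)).
  by move=> a u v; congr pair; rewrite /= ?scaler0 ?addr0.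
by move=> u v [].
Qed.

Lemma specht_supermodule_quot p (x : specht_supermodule p) : x <> 0 ->
  exists q (r : specht_supermodule p -> specht C q),
    [/\ q = p \/ q = conj_part p, linear r & r x <> 0].
Proof.
move: x; rewrite /specht_supermodule; case: pselect => [p_conj|p_conj] x x0.
  by exists p, id; split=> //; left.
have [x1|x1] := pselect (x.1 = 0).
  exists (conj_part p), snd; split=> //; first by right.
  by move=> x2; apply: x0; move: x1 x2; case: (x) => a b /= -> ->.
by exists p, fst; split=> //; left.
Qed.

(** Embed the Specht module of [p], apply the isomorphism, and project to a constituent where some
    element stays nonzero: the result is a nonzero map between Specht modules. *)
Lemma specht_supermodule_iso_eq p q :
    homogeneously_isomorphic (specht_supermodule p) (specht_supermodule q) ->
  p = q \/ p = conj_part q.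
Proof.
move=> /linear_of_homogeneous[G [G_lin G_inj]].
have [i i_lin i_inj] := specht_supermodule_sub p.
have [x x0] := nonzero_exists (specht_simple C p).1.
have Gx : G (i x) <> 0.
  by rewrite -(linear_map0 G_lin) => /G_inj; rewrite -(linear_map0 i_lin) => /i_inj.
have [r [k [rq k_lin kG]]] := specht_supermodule_quot Gx.
have -> : p = r.
  apply: (specht_hom_eq (linear_comp i_lin (linear_comp G_lin k_lin))).
  by exists x.
exact: rq.
Qed.

Lemma specht_double_part p : p <> conj_part p ->
  type_Q (specht_supermodule p) /\
  exists f : specht_supermodule p -> (specht C p * specht C (conj_part p))%type,
    [/\ module_iso f,
        f @` sm_part (specht_supermodule p) false = [set x | exists u, x = (u, phi p u)],
        f @` sm_part (specht_supermodule p) true = [set x | exists u, x = (u, - phi p u)] &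
        isotypical_components (specht_supermodule p) =
          [set f @^-1` [set x | x.2 = 0]; f @^-1` [set x | x.1 = 0]]].
Proof.
move=> pp; have := specht_supermodule_simple p; rewrite /specht_supermodule.
case: pselect => [/pp//|_] W_simple; split.
  split=> //; apply: double_supermodule_reducible; exact: specht_simple.
exists id; split.
- by split=> //; exists id.
- by rewrite image_id; exact: double_supermodule_even.
- by rewrite image_id; exact: double_supermodule_odd.
- apply: (isotypical_components_prod (specht_simple C p) (specht_simple C (conj_part p))).
    exact: specht_no_hom.
  by apply: specht_no_hom => /esym.
Qed.

Lemma specht_super_part p : p = conj_part p ->
  type_M (specht_supermodule p) /\
  exists f : specht_supermodule p -> specht C p,
    [/\ module_iso f,
        f @` sm_part (specht_supermodule p) false = specht_plus phi p &
        f @` sm_part (specht_supermodule p) true = specht_minus phi p].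
Proof.
move=> pp; have := specht_supermodule_simple p; rewrite /specht_supermodule.
case: pselect => // p_conj W_simple; split.
  by split=> //; exact: specht_simple.
exists id; split.
- by split=> //; exists id.
- rewrite image_id; apply/seteqP; split=> x; rewrite /specht_plus /sm_part /= /eigen_part /=.
    by rewrite scale1r => /(congr1 val).
  by rewrite scale1r => e; apply: val_inj.
- rewrite image_id; apply/seteqP; split=> x; rewrite /specht_minus /sm_part /= /eigen_part /=.
    by rewrite scaleN1r => /(congr1 val).
  by rewrite scaleN1r => e; apply: val_inj.
Qed.

Lemma specht_supermodule_exhaust (P : set (intpart n)) (V : supermodule (symalg_super C n)) :
    is_conj_representatives P -> simple_supermodule V ->
  exists2 p, P p & homogeneously_isomorphic V (specht_supermodule p).
Proof.
move=> [P_repr _] V_simple; have [v v0] := nonzero_exists V_simple.1.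
have [p [g [g_lin g_neq0]]] := specht_hom_exists v0.
have [q [[Pq q_p] _]] := P_repr p; exists q => //.
(* The chosen representative is either [p] itself or its conjugate, and in the latter case the map
   is first transferred. *)
case: q_p Pq => -> _; first exact: specht_supermodule_complete g_lin g_neq0.
have [h [h_lin h_neq0]] := specht_hom_conj g_lin g_neq0.
exact: specht_supermodule_complete h_lin h_neq0.
Qed.

Lemma specht_supermodule_distinct (P : set (intpart n)) p q :
    is_conj_representatives P -> P p -> P q ->
    homogeneously_isomorphic (specht_supermodule p) (specht_supermodule q) ->
  p = q.
Proof.
move=> [P_repr _] Pp Pq /specht_supermodule_iso_eq[//|p_q].
have [r [_ r_uniq]] := P_repr q.
by rewrite -(r_uniq p) 1?(r_uniq q) //; split=> //; [left|right].
Qed.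

End SpechtSupermodules.

Theorem proposition3p1p5 (R : realType) (n : nat) (P : set (intpart n))
    (phi : forall p : intpart n, specht R[i] p -> specht R[i] (conj_part p)) :
  (1 < n)%N ->
  is_conj_representatives P ->
  associator_family phi ->
  exists W : intpart n -> supermodule (symalg_super R[i] n),
  [/\ forall p : intpart n, part_E P p ->
        type_Q (W p) /\
        exists f : W p -> (specht R[i] p * specht R[i] (conj_part p))%type,
          [/\ module_iso f,
              f @` sm_part (W p) false = [set x | exists u, x = (u, phi p u)],
              f @` sm_part (W p) true = [set x | exists u, x = (u, - phi p u)] &
              isotypical_components (W p) =
                [set f @^-1` [set x | x.2 = 0]; f @^-1` [set x | x.1 = 0]]],
      forall p : intpart n, part_F P p ->
        type_M (W p) /\
        exists f : W p -> specht R[i] p,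
          [/\ module_iso f,
              f @` sm_part (W p) false = specht_plus phi p &
              f @` sm_part (W p) true = specht_minus phi p] &
      [/\ forall p, P p -> simple_supermodule (W p),
          forall V : supermodule (symalg_super R[i] n), simple_supermodule V ->
            exists2 p, P p & homogeneously_isomorphic V (W p) &
          forall p q, P p -> P q ->
            homogeneously_isomorphic (W p) (W q) -> p = q]].
Proof.
move=> _ P_repr phi_assoc; exists (specht_supermodule phi_assoc); split.
- by move=> p [_ pp]; exact: specht_double_part.
- by move=> p [_ pp]; exact: specht_super_part.
split.
- by move=> p _; exact: specht_supermodule_simple.
- by move=> V; exact: specht_supermodule_exhaust.
- by move=> p q; exact: specht_supermodule_distinct.
Qed.
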